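(* Assume that $\Omega$ is finitely connected at the boundary. Then there is a homeomorphism $\Phi:\overline\Omega^P\to\overline\Omega^M$ such that $\Phi|_\Omega$ is the identity map. Moreover, the prime end closure $\overline\Omega^P$ is metrizable with the metric $m_P(x,y):=d_M(\Phi(x),\Phi(y))$. The topology on $\overline\Omega^P$ given by this metric is equivalent to the topology on $\overline\Omega^P$ given by the sequential convergence of points and ends.
   Context: Setting: $(X,d,\mu)$ is a metric measure space with more than one point, $\mu$ is a Borel measure with $0<\mu(B)<\infty$ for all balls $B$, and $1\le p<\infty$ is fixed. $X$ is complete, $\mu$ is doubling (there is $C_\mu>0$ with $\mu(B(x,2r))\le C_\mu\mu(B(x,r))$ for all balls), and $X$ supports a $p$-Poincaré inequality: there are $C_{PI}>0$, $\lambda\ge1$ such that for all balls $B$ and all $u\in N^{1,p}(X)$, $\frac{1}{\mu(B)}\int_B|u-u_B|\,d\mu\le C_{PI}\operatorname{diam}(B)\bigl(\frac{1}{\mu(\lambda B)}\int_{\lambda B}g_u^p\,d\mu\bigr)^{1/p}$, where $u_B=\frac{1}{\mu(B)}\int_B u\,d\mu$. Here a nonnegative Borel function $g$ is an upper gradient of $u:X\to[-\infty,\infty]$ if for every nonconstant rectifiable curve $\gamma:[0,l_\gamma]\to X$ parameterized by arc length, $|u(\gamma(0))-u(\gamma(l_\gamma))|\le\int_\gamma g\,ds$ when both values are finite, and $\int_\gamma g\,ds=\infty$ otherwise; $N^{1,p}(X)$ is the space of measurable $u$ with $\int_X|u|^p\,d\mu+\inf_g\int_X g^p\,d\mu<\infty$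 (infimum over upper gradients $g$ of $u$), and $g_u$ is the minimal $p$-weak upper gradient of $u$ (the a.e.-smallest $L^p$ function satisfying the upper gradient inequality for all curves except a family $\Gamma$ for which some nonnegative Borel $\rho\in L^p(X)$ has $\int_\gamma\rho\,ds=\infty$ for all $\gamma\in\Gamma$). $\Omega\subsetneq X$ is a bounded domain (bounded nonempty connected open set); closures and boundaries of subsets of $\Omega$ are taken in $X$. Ends: A bounded connected set $E\subsetneq\Omega$ is acceptable if $\overline E\cap\partial\Omega\ne\varnothing$. A sequence $\{E_k\}_{k=1}^\infty$ of acceptable sets is a chain if (i) $E_{k+1}\subset E_k$ for all $k$; (ii) $\operatorname{dist}(\Omega\cap\partial E_{k+1},\Omega\cap\partial E_k)>0$ for all $k$; (iii) the impression $\bigcap_{k=1}^\infty\overline{E}_k$ is contained in $\partial\Omega$. A chain $\{E_k\}$ divides a chain $\{F_k\}$ if for each $k$ there is $l$ with $E_l\subset F_k$. Two chains are equivalent if they divide each other; an end $[E_k]$ is an equivalence class of chains. Division is well defined between ends. A prime end is an end that is not divisible by any other end. $\partial_E\Omega$ is the set of all ends, $\partial_P\Omega$ the set of all prime ends, and $\overline\Omega^P=\Omega\cup\partial_P\Omega$ is the prime end closure. Topology on $\Omega\cup\partial_E\Omega$: a sequence of points $\{x_n\}$ in $\Omega$ converges to the end $[E_k]$ if for all $k$ there is $n_k$ with $x_n\in E_k$ whenever $n\ge n_k$. A sequence of ends $\{[E_k^n]\}_{n=1}^\infty$ converges to the end $[E_k^\infty]$ if for every $k$ there is $n_k$ such that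 for each $n\ge n_k$ there is $l_{n,k}$ with $E^n_{l_{n,k}}\subset E_k^\infty$. Points of $\Omega$ converge to points of $\Omega$ as in the metric topology, and no sequence of ends converges to a point of $\Omega$. A set $C\subset\Omega\cup\partial_E\Omega$ is closed if every $y\in\Omega\cup\partial_E\Omega$ which is a limit of a sequence in $C$ belongs to $C$. $\overline\Omega^P$ carries the induced topology (this is the topology given by sequential convergence). Mazurkiewicz closure: for $x,y\in\Omega$, $d_M(x,y)=\inf\operatorname{diam}E$, the infimum over all connected sets $E\subset\Omega$ containing $x$ and $y$; this is a metric on $\Omega$. $\overline\Omega^M$ is the completion of $(\Omega,d_M)$ (with $\Omega$ identified with its image, and with the extended metric $d_M$). Finite connectedness: $\Omega$ is finitely connected at $x_0\in\partial\Omega$ if for every $r>0$ there is an open set $G\subset X$ with $x_0\in G\subset B(x_0,r)$ such that $G\cap\Omega$ has only finitely many components. $\Omega$ is finitely connected at the boundary if this holds at every $x_0\in\partial\Omega$. *)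

(* Defs.v *)
From HB Require Import structures.
From mathcomp Require Import all_boot all_order all_algebra.
From mathcomp Require Import all_classical all_reals all_analysis.
From mathcomp Require Import measurable_realfun.

Set Implicit Arguments.
Unset Strict Implicit.
Unset Printing Implicit Defensive.

Import Order.TTheory GRing.Theory Num.Theory.
Import numFieldNormedType.Exports.

Local Open Scope classical_set_scope.
Local Open Scope ring_scope.

#[short(type="completeMetricType")]
HB.structure Definition CompleteMetric (K : numDomainType) :=
  { M of Metric K M & Complete M }.

Notation borel X := (g_sigma_algebraType (@open X)).

Section metric_notions.
Context {R : realType} {X : metricType R}.
Implicit Types A B : set X.

Definition boundary A : set X := closure A `\` interior A.

(* -oo when A is empty *)
Definition diam A : \bar R :=
  ereal_sup [set (mdist x y)%:E | x in A & y in A].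

(* +oo when A or B is empty *)
Definition set_dist A B : \bar R :=
  ereal_inf [set (mdist x y)%:E | x in A & y in B].

Definition bounded_domain A : Prop :=
  [/\ A !=set0, open A, connected A & (diam A < +oo)%E].

Definition finitely_connected_at A (x0 : X) : Prop :=
  forall r : R, 0 < r -> exists G : set X,
    [/\ open G, G x0, G `<=` ball x0 r &
        finite_set [set connected_component (G `&` A) x | x in G `&` A]].

Definition finitely_connected_at_boundary A : Prop :=
  forall x0, boundary A x0 -> finitely_connected_at A x0.

End metric_notions.

Section newtonian.
Local Open Scope ereal_scope.
Context {R : realType}.

Section curves.
Context {X : metricType R}.

Definition curve_variation (gamma : R -> X) (a : R) (s : seq R) : R :=
  (\sum_(i < size s)
     mdist (gamma (nth a (a :: s) i)) (gamma (nth a (a :: s) i.+1)))%R.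

Definition curve_length (gamma : R -> X) (a b : R) : \bar R :=
  ereal_sup [set (curve_variation gamma a s)%:E | s in [set s : seq R |
    path <=%R a s /\ last a s = b]].

(* The pair (l, gamma) stands for gamma restricted to [0, l].  A curve
   parameterized by arc length is nonconstant iff l > 0. *)
Definition arc_length_curve (c : R * (R -> X)) : Prop :=
  (0 < c.1)%R /\ forall s t : R, (0 <= s)%R -> (s <= t)%R -> (t <= c.1)%R ->
    curve_length c.2 s t = (t - s)%:E.

Definition curve_integral (g : X -> \bar R) (c : R * (R -> X)) : \bar R :=
  \int[lebesgue_measure]_(t in `[0%R, c.1]) g (c.2 t).

Definition upper_gradient_ineq (u g : X -> \bar R) (c : R * (R -> X)) : Prop :=
  let a := u (c.2 0%R) in let b := u (c.2 c.1) in
  if (a \is a fin_num) && (b \is a fin_num)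
  then (`|a - b| <= curve_integral g c : Prop)
  else curve_integral g c = +oo.

End curves.

Context {X : completeMetricType R}.
Variables (mu : {measure set (borel X) -> \bar R}) (p : R).
Implicit Types u g h rho : X -> \bar R.

Definition nneg_borel g : Prop :=
  measurable_fun [set: borel X] (g : borel X -> \bar R) /\ forall x, 0 <= g x.

(* Measurability with respect to the completion of mu: for such u, the
   integrals below are the integrals against the completed measure. *)
Definition mu_measurable u : Prop := exists v : borel X -> \bar R,
  measurable_fun [set: borel X] v /\ {ae mu, forall x, u x = v x}.

Definition upper_gradient u g : Prop :=
  nneg_borel g /\ forall c, arc_length_curve c -> upper_gradient_ineq u g c.

Definition Lp_energy u : \bar R := \int[mu]_x (`|u x| `^ p).

Definition exceptional (Gamma : set (R * (R -> X))) : Prop :=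
  exists rho, [/\ nneg_borel rho, Lp_energy rho < +oo &
    forall c, Gamma c -> arc_length_curve c -> curve_integral rho c = +oo].

Definition weak_upper_gradient u g : Prop :=
  nneg_borel g /\ exists Gamma, exceptional Gamma /\
    forall c, arc_length_curve c -> ~ Gamma c -> upper_gradient_ineq u g c.

Definition minimal_weak_upper_gradient u g : Prop :=
  [/\ weak_upper_gradient u g, Lp_energy g < +oo &
      forall h, weak_upper_gradient u h -> Lp_energy h < +oo ->
        {ae mu, forall x, g x <= h x}].

Definition newtonian u : Prop :=
  mu_measurable u /\
  Lp_energy u + ereal_inf [set Lp_energy g | g in upper_gradient u] < +oo.

Definition average (B : set X) u : \bar R :=
  ((fine (mu B))^-1)%:E * \int[mu]_(x in B) u x.

Definition finite_positive_on_balls : Prop :=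
  forall (x : X) (r : R), (0 < r)%R -> 0 < mu (ball x r) < +oo.

Definition doubling : Prop :=
  exists2 C : R, (0 < C)%R & forall (x : X) (r : R), (0 < r)%R ->
    mu (ball x (2 * r)%R) <= C%:E * mu (ball x r).

(* The minimal p-weak upper gradient g of u is unique up to a null set. *)
Definition poincare : Prop :=
  exists C lambda : R, [/\ (0 < C)%R, (1 <= lambda)%R &
    forall u, newtonian u -> exists2 g, minimal_weak_upper_gradient u g &
      forall (x : X) (r : R), (0 < r)%R ->
        let B := ball x r in
        average B (fun y => `|u y - average B u|) <=
        C%:E * diam B *
          (average (ball x (lambda * r)%R) (fun y => g y `^ p)) `^ p^-1].

End newtonian.

Section prime_ends.
Context {R : realType} {X : metricType R}.
Variable Omega : set X.

Definition acceptable (E : set X) : Prop :=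
  [/\ E `<` Omega, connected E, (diam E < +oo)%E &
      closure E `&` boundary Omega !=set0].

Definition chain (E : nat -> set X) : Prop :=
  [/\ forall k, acceptable (E k),
      forall k, E k.+1 `<=` E k,
      forall k, (0 < set_dist (Omega `&` boundary (E k.+1))
                              (Omega `&` boundary (E k)))%E &
      \bigcap_k closure (E k) `<=` boundary Omega].

Definition chain_divides (E F : nat -> set X) : Prop :=
  forall k, exists l, E l `<=` F k.

Definition chain_equiv (E F : nat -> set X) : Prop :=
  chain_divides E F /\ chain_divides F E.

Record end_ := End {
  end_class : set (nat -> set X) ;
  end_classP : exists2 E, chain E &
    end_class = [set F | chain F /\ chain_equiv E F] }.

(* does not depend on the choice of the representatives *)
Definition end_divides (e f : end_) : Prop :=
  exists E F, [/\ end_class e E, end_class f F & chain_divides E F].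

Definition prime_end (e : end_) : Prop :=
  forall f : end_, end_divides f e -> f = e.

Variant ends_closure := ptE of Omega | endE of end_.

HB.instance Definition _ := gen_eqMixin ends_closure.
HB.instance Definition _ := gen_choiceMixin ends_closure.

(* The choice of representatives is immaterial here too. *)
Definition points_cvg_end (x : nat -> Omega) (e : end_) : Prop :=
  exists2 E, end_class e E & forall k, exists nk, forall n, (nk <= n)%N ->
    E k (set_val (x n)).

Definition ends_cvg_end (e : nat -> end_) (f : end_) : Prop :=
  exists (E : nat -> nat -> set X) (F : nat -> set X),
    [/\ forall n, end_class (e n) (E n), end_class f F &
      forall k, exists nk, forall n, (nk <= n)%N ->
        exists l, E n l `<=` F k].

Inductive seq_cvg : (nat -> ends_closure) -> ends_closure -> Prop :=
| cvg_points_point (x : nat -> Omega) (a : Omega) :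
    ((fun n => set_val (x n) : X) @ \oo --> (set_val a : X)) ->
    seq_cvg (fun n => ptE (x n)) (ptE a)
| cvg_points_end (x : nat -> Omega) (e : end_) :
    points_cvg_end x e -> seq_cvg (fun n => ptE (x n)) (endE e)
| cvg_ends_end (e : nat -> end_) (f : end_) :
    ends_cvg_end e f -> seq_cvg (fun n => endE (e n)) (endE f).

Definition seq_closed (C : set ends_closure) : Prop :=
  forall z y, (forall n, C (z n)) -> seq_cvg z y -> C y.

Lemma seq_cvg_sub (z : nat -> ends_closure) (y : ends_closure)
    (s : nat -> nat) : (forall n, (n <= s n)%N) ->
  seq_cvg z y -> seq_cvg (fun n => z (s n)) y.
Proof.
move=> ns [x a xa|x e [E eE xE]|e f [E [F [eE fF EF]]]].
- apply: (@cvg_points_point (x \o s)).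
  apply: (cvg_comp _ _ _ xa) => A [N _ NA]; exists N => // n /= Nn.
  by apply: NA; exact: leq_trans (ns n).
- apply: (@cvg_points_end (x \o s)); exists E => // k.
  by have [N Nx] := xE k; exists N => n Nn; apply: Nx; exact: leq_trans (ns n).
- apply: (@cvg_ends_end (e \o s)); exists (E \o s), F; split => [n|//|k] /=.
    exact: eE.
  by have [N Nx] := EF k; exists N => n Nn; apply: Nx; exact: leq_trans (ns n).
Qed.

Lemma seq_closedU (C D : set ends_closure) :
  seq_closed C -> seq_closed D -> seq_closed (C `|` D).
Proof.
move=> cC cD z y zCD zy.
have [inf|] := pselect (forall N, exists n, (N <= n)%N /\ C (z n)).
  have [s sP] := choice inf; left.
  apply: (cC (fun n => z (s n))) => [n|].
    by have [] := sP n.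
  by apply: seq_cvg_sub zy => n; have [] := sP n.
move=> /existsNP[N /forallNP zNC]; right.
apply: (cD (fun n => z (N + n)%N)) => [n|].
  have [Cz|//] := zCD (N + n)%N.
  by exfalso; apply: (zNC (N + n)%N); split; rewrite ?leq_addr.
by apply: seq_cvg_sub zy => n; rewrite leq_addl.
Qed.

Let seq_open : set (set ends_closure) := [set U | seq_closed (~` U)].

Let seq_openT : seq_open setT.
Proof. by move=> z y /(_ 0%N) /(_ I). Qed.

Let seq_openI : setI_closed seq_open.
Proof. by move=> U V oU oV; rewrite /seq_open /= setCI; exact: seq_closedU. Qed.

Let seq_open_bigcup (I : Type) (U : I -> set ends_closure) :
  (forall i, seq_open (U i)) -> seq_open (\bigcup_i U i).
Proof.
move=> oU z y zU zy [i _ Uiy].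
by apply: (oU i z y) => // n Uiz; apply: (zU n); exists i.
Qed.

HB.instance Definition _ :=
  isOpenTopological.Build ends_closure seq_openT seq_openI seq_open_bigcup.

(* Coerced to a type, it carries the topology induced by [ends_closure]. *)
Definition prime_end_closure : set ends_closure :=
  [set y | if y is endE e then prime_end e else True].

Definition ptP (x : Omega) : prime_end_closure :=
  exist _ (ptE x) (@mem_set _ prime_end_closure (ptE x) I).

Definition prime_seq_closed (C : set prime_end_closure) : Prop :=
  forall (z : nat -> prime_end_closure) (y : prime_end_closure),
    (forall n, C (z n)) -> seq_cvg (fun n => set_val (z n)) (set_val y) -> C y.

(* The infimum is finite for x, y in Omega when Omega is a bounded domain. *)
Definition mazurkiewicz (x y : X) : R :=
  fine (ereal_inf [set diam E | E in [set E : set X |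
    [/\ connected E, E `<=` Omega, E x & E y]]]).

End prime_ends.

Arguments prime_end_closure {R X} Omega _.
Arguments ptP {R X Omega} x.

Definition mazurkiewicz_completion (R : realType) (X : metricType R)
    (Omega : set X) (M : completeMetricType R) (iota : Omega -> M) : Prop :=
  (forall x y : Omega,
     mdist (iota x) (iota y) = mazurkiewicz Omega (set_val x) (set_val y)) /\
  dense (range iota).

Definition homeomorphism (S T : topologicalType) (f : S -> T) : Prop :=
  continuous f /\
  exists2 g : T -> S, cancel f g /\ cancel g f & continuous g.

Section metrics.
Context {R : realType} {T : Type}.

Definition is_metric (d : T -> T -> R) : Prop :=
  [/\ forall x y, 0 <= d x y, forall x y, d x y = 0 <-> x = y,
      forall x y, d x y = d y x & forall x y z, d x z <= d x y + d y z].

Definition metric_open (d : T -> T -> R) (A : set T) : Prop :=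
  forall x, A x -> exists2 r : R, 0 < r & [set y | d x y < r] `<=` A.

End metrics.

(* Main.v *)
(* Two facts about [X] are extracted from the measure: closed balls are compact
   (completeness and doubling) and [X] is locally connected.  For the latter,
   let [J] be the set of points that can be reached from [x0] inside
   [ball x0 r] by jumps of length less than [e].  The function equal to
   [r - d(x0, .)] on [J] and to 0 elsewhere is 1-Lipschitz at the scale [e], so
   that the indicator of the ball is an upper gradient; telescoping the
   Poincare inequality over dyadic balls shows that [J] contains
   [ball x0 (r / L)], with [L] independent of [e].  The intersection of the sets
   [J] over all [e] in a compact ball is connected.

   Finite connectedness at the boundary covers [Omega] by finitely many sets of
   small Mazurkiewicz diameter, so that the completion [M] is compact.  A point
   [m] of [M] outside [Omega] lies over a boundary point [proj m] of [Omega]; the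
   component of [Omega `&` ball (proj m) r] that approaches [m] (the neck of [m])
   contains the trace of a ball of [M] about [m] and has small Mazurkiewicz
   diameter, and the necks form a chain.  By compactness every chain has an
   adherent point [m] in [M], and necks of [m], being connected and small, cannot
   cross the gap between the boundaries of two consecutive sets of the chain; so
   the end of the necks of [m] divides the chain.  Hence the prime ends are
   exactly the ends of the necks, one for each such [m]. *)
Require Import Defs.
From mathcomp Require Import all_boot all_order all_algebra.
From mathcomp Require Import all_classical all_reals all_analysis.
From mathcomp Require Import measurable_realfun ring lra.

Set Implicit Arguments.
Unset Strict Implicit.
Unset Printing Implicit Defensive.

Import Order.TTheory GRing.Theory Num.Theory.
Import numFieldNormedType.Exports.

Local Open Scope classical_set_scope.
Local Open Scope ring_scope.

(** * Balls, closures and boundaries in a metric space *)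

Section metric_balls.
Context {R : realType} {X : metricType R}.
Implicit Types (x y z : X) (A B K P Q : set X).

Lemma nbhs_mdist x A :
  nbhs x A <-> exists2 e : R, 0 < e & forall y, mdist x y < e -> A y.
Proof.
by rewrite -metricType_numDomainType.filter_from_mdist_nbhs.
Qed.

Lemma closure_mdist A x :
  closure A x <-> forall e : R, 0 < e -> exists2 y, A y & mdist x y < e.
Proof.
split=> [Ax e e0|Ax B /nbhs_mdist[e e0 eB]].
  have /nbhs_mdist/Ax[y [Ay xy]] :
    exists2 d : R, 0 < d & forall y, mdist x y < d -> mdist x y < e by exists e.
  by exists y.
by have [y Ay /eB By] := Ax e e0; exists y.
Qed.

Lemma open_mdist A :
  open A <-> forall x, A x -> exists2 e : R, 0 < e & forall y, mdist x y < e -> A y.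
Proof.
rewrite openE; split=> oA x /oA; first by move=> /nbhs_mdist.
by move=> h; apply/nbhs_mdist.
Qed.

Lemma mdist_ball_open x (r : R) : open (ball x r).
Proof.
apply/open_mdist => y; rewrite ballEmdist /= => xy.
exists (r - mdist x y) => [|z]; first by rewrite subr_gt0.
by rewrite ltrBrDl; exact/le_lt_trans/metric_triangle.
Qed.

Definition totally_bounded A := forall e : R, 0 < e ->
  exists s : seq X, forall x, A x -> exists2 y, y \in s & mdist y x < e.

(** If [C] missed the boundary of [A], the closure and the interior of [A] would have the same trace
    on [C], which would be both open and closed in [C]. *)
Lemma connected_boundary A C :
  connected C -> C `&` A !=set0 -> C `\` A !=set0 ->
  C `&` boundary A !=set0.
Proof.
move=> cC [a [Ca Aa]] [b [Cb Ab]]; apply: contrapT => /forallNP nb.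
have CA x : C x -> closure A x -> interior A x.
  by move=> Cx clx; apply: contrapT => nix; apply: (nb x).
suff : C `&` A = C by move=> E; move: Cb; rewrite -E => -[].
apply: cC; first by exists a.
- exists (interior A); first exact: open_interior.
  apply/seteqP; split=> x [Cx Ax]; split => //.
    by apply: CA => //; exact: subset_closure.
  exact: interior_subset.
- exists (closure A); first exact: closed_closure.
  apply/seteqP; split=> x [Cx Ax]; split => //; first exact: subset_closure.
  by apply: interior_subset; exact: CA.
Qed.

End metric_balls.

(** An ultrafilter containing [A] contains, at every scale [e], one of finitely many balls; it is
    therefore Cauchy and converges. *)
Lemma totally_bounded_compact {R : realType} {X : completeMetricType R}
    (A : set X) : closed A -> totally_bounded A -> compact A.
Proof.
move=> clA tbA; rewrite compact_ultra => F FU FA.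
have /cauchy_cvg Fcvg : cauchy F.
  apply: cauchy_exP => e /tbA[s sA].
  have : F [set x | exists2 y, y \in s & mdist y x < e] by exact: filterS FA.
  elim: s {sA} => [|y s IHs] Fs.
    by have [x []] := filter_ex Fs.
  have [Fy|Fy] := in_ultra_setVsetC (ball y e) FU; first by exists y.
  apply: IHs; apply: filterS (filterI Fs Fy) => x [[z]].
  rewrite inE => /predU1P[->|zs zx]; last by exists z.
  by rewrite ballEmdist.
exists (lim F); split => //.
by apply: clA => B /Fcvg FB; exact: filter_ex (filterI FA FB).
Qed.

Lemma nbhs_0_right (R : realType) (P : set R) :
  nbhs 0^'+ P <-> exists2 d : R, 0 < d & forall e, 0 < e < d -> P e.
Proof.
split=> [|[d d0 dP]].
  move=> /nbhs_ballP[d /= d0 dP]; exists d => // e /andP[e0 ed].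
  by apply: dP => //=; rewrite /ball /= sub0r normrN gtr0_norm.
near=> e; apply: dP; apply/andP; split => //.
Unshelve. all: by end_near. Qed.

(** * Jump components and connected sets obtained from them *)

Section chains.
Context {R : realType} {X : metricType R}.
Implicit Types (x y z : X) (K U : set X).

(* Reachability from [x] by finitely many jumps of length less than [e] inside
   [U], defined impredicatively. *)
Definition jump_component U (e : R) x : set X :=
  [set y | forall S : set X, S x ->
    (forall z w, S z -> U w -> mdist z w < e -> S w) -> S y].

Lemma jump_component_refl U e x : jump_component U e x x.
Proof. by move=> S. Qed.

Lemma jump_component_step U e x y z :
  jump_component U e x y -> U z -> mdist y z < e -> jump_component U e x z.
Proof. by move=> xy Uz yz S Sx SU; apply: (SU y) => //; exact: xy. Qed.

Lemma jump_component_sub U e x : U x -> jump_component U e x `<=` U.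
Proof. by move=> Ux y; apply. Qed.

Lemma le_jump_component U V (e f : R) x : U `<=` V -> e <= f ->
  jump_component U e x `<=` jump_component V f x.
Proof.
move=> UV ef y xy S Sx SV; apply: xy => // z w Sz Uw zw.
by apply: (SV z) => //; [exact: UV|exact: lt_le_trans ef].
Qed.

(* If the intersection were the union of two far apart closed sets, then by
   compactness a component for small jumps would lie near them, and no small
   jump leads from one to the other. *)
Lemma compact_jump_connected K x : compact K -> K x ->
  connected (\bigcap_(e in [set e : R | 0 < e]) jump_component K e x).
Proof.
move=> cK Kx; set Q := \bigcap_(e in _) _.
have clK : closed K by apply: compact_closed => //; exact: metric_hausdorff.
have QK : Q `<=` K by move=> y /(_ 1 ltr01) /(jump_component_sub Kx).
have Qx : Q x by move=> e _; exact: jump_component_refl.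
have clQ : closed Q.
  move=> y /closure_mdist Qy; have Ky : K y.
    by apply: clK; apply/closure_mdist => e /Qy[z /QK Kz yz]; exists z.
  move=> e e0; have [z /(_ e e0) Qz] := Qy e e0.
  by rewrite metric_sym; exact: jump_component_step.
(* Stated for an ordered pair of pieces, because either of the two may be the one that contains
   [x]. *)
have split_Q P P' : closed P -> closed P' -> P `&` P' = set0 ->
    Q = P `|` P' -> P x -> P' = set0.
  move=> clP clP' PP' QE Px.
  have cP : compact P.
    apply: (subclosed_compact clP cK); apply: subset_trans QK.
    by rewrite QE; exact: subsetUl.
  (* The factor 3 keeps the [eta]-neighbourhoods [V] and [V'] of the two pieces more than [eta]
     apart. *)
  have [eta eta0 etaP] : exists2 eta : R, 0 < eta &
      forall p q, P p -> P' q -> 3 * eta <= mdist p q.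
    have /compact_near_coveringP/(_ _ (0^'+ : set_system R)
        (fun e z => forall q, P' q -> 3 * e <= mdist z q)) := cP.
    rewrite /prop_near1 nbhs_0_right; case=> [p Pp|e /= e0 h].
    - have P'p : (~` P') p.
        by move=> P'p; have : (P `&` P') p by []; rewrite PP'.
      have [d d0 dP'] := (open_mdist _).1 (closed_openC clP') _ P'p.
      exists (ball p (d / 4), [set e | 0 < e < d / 4]); first split => /=.
      + by apply: nbhsx_ballx; rewrite divr_gt0.
      + by apply/nbhs_0_right; exists (d / 4); rewrite ?divr_gt0.
      + move=> [z e] /= [+ /andP[e0 ed]] q P'q; rewrite ballEmdist /= => pz.
        have : d <= mdist p q by rewrite leNgt; apply/negP => /dP'.
        by have := metric_triangle p z q; lra.
    - have e2 : 0 < e / 2 by rewrite divr_gt0.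
      exists (e / 2) => // p q Pp P'q.
      by apply: (h (e / 2)) => //; lra.
  pose V := [set z | exists2 p, P p & mdist p z < eta].
  pose V' := [set z | exists2 p, P' p & mdist p z < eta].
  have VV' z w : V z -> V' w -> eta < mdist z w.
    move=> [p Pp pz] [q P'q qw]; have := etaP _ _ Pp P'q.
    have := metric_triangle p z q; have := metric_triangle z w q.
    by rewrite (metric_sym w q); lra.
  have oV S : open [set z | exists2 p, S p & mdist p z < eta].
    apply/open_mdist => z [p Sp pz]; exists (eta - mdist p z).
      by rewrite subr_gt0.
    move=> w; rewrite ltrBrDl => pzw; exists p => //.
    exact: le_lt_trans (metric_triangle p z w) pzw.
  pose Z := K `\` (V `|` V').
  have cZ : compact Z.
    apply: (subclosed_compact _ cK); last by move=> z [].
    by rewrite /Z setDE; apply: closedI => //; apply/open_closedC/openU; exact: oV.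
  (* A point of [Z] is outside [Q], so jumps of some length do not reach it, nor do shorter jumps
     reach its neighbours; compactness gives one length for all of [Z]. *)
  have /compact_near_coveringP/near_covering_withinP/(_ _ (0^'+ : set_system R)
        (fun e z => ~ jump_component K e x z)) := cZ.
  rewrite /prop_near1 nbhs_0_right; case=> [z [Kz nVz]|e /= e0 h].
  - have /existsNP[d /not_implyP[/= d0 nd]] : ~ Q z.
      rewrite QE => -[Pz|P'z]; apply: nVz; [left|right];
        by exists z; rewrite // mdistxx.
    exists (ball z d, [set e | 0 < e < d]); first split => /=.
    + exact: nbhsx_ballx.
    + by apply/nbhs_0_right; exists d.
    + move=> [w e] /= [+ /andP[e0 ed]] [Kw nVw]; rewrite ballEmdist /= => zw ew.
      apply: nd; apply: (@jump_component_step _ _ _ w) => //.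
        exact: le_jump_component (ltW ed) _ ew.
      by rewrite metric_sym.
  - pose d := Num.min (e / 2) eta.
    have d0 : 0 < d by rewrite lt_min eta0 divr_gt0.
    have deta : d <= eta by rewrite ge_min lexx orbT.
    have de : d < e.
      by apply: (@le_lt_trans _ _ (e / 2)); [rewrite ge_min lexx|lra].
    have {}h z : jump_component K d x z -> V z \/ V' z.
      move=> xz; apply: contrapT => nVz; apply: (h d _ z) => //.
        by rewrite d0.
      by split => //; exact: (jump_component_sub Kx) xz.
    (* Jumps shorter than [d <= eta] cannot pass from [V] to [V'], and every point reached lies in
       one of the two. *)
    have JV : jump_component K d x `<=` jump_component K d x `&` V.
      move=> y; apply=> [|z w [xz Vz] Kw zw].
        by split; [exact: jump_component_refl|exists x; rewrite // mdistxx].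
      have xw := jump_component_step xz Kw zw; split => //.
      have [//|V'w] := h _ xw.
      by have := VV' _ _ Vz V'w; rewrite ltNge => /negP; case; lra.
    apply/seteqP; split => // b P'b.
    have /(_ d d0)/JV[_ Vb] : Q b by rewrite QE; right.
    have V'b : V' b by exists b; rewrite // mdistxx.
    by have := VV' _ _ Vb V'b; rewrite mdistxx; lra.
move=> B [b Bb] [C oC BC] [D clD BD].
have clB : closed B by rewrite BD; exact: closedI.
have clB' : closed (Q `\` B).
  rewrite (_ : Q `\` B = Q `&` ~` C).
    by apply: closedI => //; exact: open_closedC.
  rewrite BC; apply/seteqP; split => y [Qy nBy]; split => //.
    by move=> Cy; apply: nBy.
  by move=> [].
have BQ : B `<=` Q by rewrite BC; exact: subIsetl.
have [Bx|nBx] := pselect (B x).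
  have := split_Q _ _ clB clB'; rewrite setDIK => /(_ erefl).
  rewrite setDUK// => /(_ erefl Bx) QB.
  apply/seteqP; split => // y Qy; apply: contrapT => nBy.
  by have : (Q `\` B) y by []; rewrite QB.
have := split_Q _ _ clB' clB; rewrite setIC setDIK => /(_ erefl).
rewrite setUC setDUK// => /(_ erefl (conj Qx nBx)) B0.
by move: Bb; rewrite B0.
Qed.

End chains.

(** * Doubling measures: closed balls are compact *)

Section doubling_measure.
Context {R : realType} {X : completeMetricType R}.
Variable mu : {measure set (borel X) -> \bar R}.
Implicit Types (x y z : X) (A B : set X) (r : R).

Lemma open_borel A : open A -> measurable (A : set (borel X)).
Proof. by move=> oA; exact: sub_sigma_algebra. Qed.

Lemma ball_borel x r : measurable (ball x r : set (borel X)).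
Proof. by apply: open_borel; exact: mdist_ball_open. Qed.

Hypothesis mu_ball : finite_positive_on_balls mu.

Let m x r := fine (mu (ball x r)).

Let mE x r : 0 < r -> mu (ball x r) = (m x r)%:E.
Proof.
move=> r0; have /andP[m0 moo] := mu_ball x r0; rewrite fineK//.
by rewrite ge0_fin_numE// ltW.
Qed.

Lemma fine_ball_gt0 x r : 0 < r -> 0 < fine (mu (ball x r)).
Proof. by move=> r0; have := mu_ball x r0; rewrite mE// lte_fin => /andP[]. Qed.

Let le_m x r y s : 0 < r -> ball x r `<=` ball y s -> m x r <= m y s.
Proof.
move=> r0 rs; have s0 : 0 < s.
  have /rs : ball x r x by exact: ballxx.
  by rewrite ballEmdist => /=; apply: le_lt_trans; exact: mdist_ge0.
by rewrite -lee_fin -!mE//; apply: le_measure => //; rewrite inE; exact: ball_borel.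
Qed.

Definition doubling_const (C : R) : Prop := forall x r, 0 < r ->
  fine (mu (ball x (2 * r))) <= C * fine (mu (ball x r)).

Lemma doubling_constP : doubling mu -> exists2 C : R, 0 < C & doubling_const C.
Proof.
move=> [C C0 muC]; exists C => // x r r0.
by have := muC x r r0; rewrite !mE ?mulr_gt0// -EFinM lee_fin.
Qed.

Lemma doubling_iter C x r n : 0 < C -> doubling_const C -> 0 < r ->
  fine (mu (ball x (2 ^+ n * r))) <= C ^+ n * fine (mu (ball x r)).
Proof.
move=> C0 muC r0; elim: n => [|n IHn]; first by rewrite !expr0 !mul1r.
rewrite !exprS -!mulrA; apply: (le_trans (muC _ _ _)).
  by rewrite mulr_gt0// exprn_gt0.
by rewrite ler_pM2l.
Qed.

(** Otherwise one could choose endlessly many points of the ball at mutual distance at least [e].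
    The balls of radius [e / 2] about them are disjoint and, by doubling, their measures have a
    common positive lower bound, while their union lies in [ball x (r + e)]. *)
Lemma doubling_totally_bounded C x r : 0 < C -> doubling_const C -> 0 < r ->
  totally_bounded (ball x r).
Proof.
move=> C0 muC r0 e e0; apply: contrapT => /forallNP notb.
have /choice[f fP] : forall s : seq X, exists y, ball x r y /\
    forall z, z \in s -> e <= mdist z y.
  move=> s; have /existsNP[y /not_implyP[xy /forall2NP h]] := notb s.
  exists y; split => // z zs; rewrite leNgt; apply/negP => zy.
  by have [] := h z.
(* [S n] lists the first [n] points chosen, the most recent one first. *)
pose S n := iter n (fun s => f s :: s) [::].
pose B n : set X := [set z | exists2 y, y \in S n & mdist y z < e / 2].
have e20 : 0 < e / 2 by rewrite divr_gt0.
have oB n : open (B n).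
  apply/open_mdist => z [y yS yz]; exists (e / 2 - mdist y z).
    by rewrite subr_gt0.
  move=> w; rewrite ltrBrDl => yzw; exists y => //.
  exact: le_lt_trans (metric_triangle y z w) yzw.
have BS n : B n.+1 = ball (f (S n)) (e / 2) `|` B n.
  apply/seteqP; split=> z; rewrite /B /= ballEmdist /=.
    by move=> [y]; rewrite inE => /predU1P[->|yS yz]; [left|right; exists y].
  move=> [fz|[y yS yz]]; first by exists (f (S n)); rewrite ?mem_head.
  by exists y => //; rewrite inE yS orbT.
(* After [k] doublings, the ball of radius [e / 2] about any point of [ball x r] contains
   [ball x (r + e)]. *)
have [k kP] : exists k, 2 * r + e <= 2 ^+ k * (e / 2).
  have [k kP] : exists k : nat, (2 * r + e) / (e / 2) < k%:R.
    exists (Num.truncn ((2 * r + e) / (e / 2))).+1.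
    exact: truncnS_gt.
  exists k; rewrite -ler_pdivrMr//; apply: (le_trans (ltW kP)).
  by rewrite -natrX ler_nat ltnW// ltn_expl.
pose T := m x (r + e).
have T0 : 0 < T by rewrite fine_ball_gt0// addr_gt0.
have cP y : ball x r y -> T / C ^+ k <= m y (e / 2).
  rewrite ballEmdist /= => xy; rewrite ler_pdivrMr ?exprn_gt0// mulrC.
  apply: le_trans (doubling_iter _ _ C0 muC e20).
  apply: le_m; first by rewrite addr_gt0.
  move=> z; rewrite !ballEmdist /= => xz; apply: lt_le_trans kP.
  by have := metric_triangle y x z; rewrite (metric_sym y x); lra.
have Bx n : B n `<=` ball x (r + e).
  move=> z [y yS yz]; rewrite ballEmdist /=.
  have : ball x r y.
    elim: n yS => [//|n IHn]; rewrite inE => /predU1P[->|/IHn//].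
    by have [] := fP (S n).
  by rewrite ballEmdist /=; have := metric_triangle x y z; lra.
have muB n : ((n%:R * (T / C ^+ k))%:E <= mu (B n))%E.
  elim: n => [|n IHn]; first by rewrite mul0r.
  rewrite BS.
  have -> : mu (ball (f (S n)) (e / 2) `|` B n) =
      (mu (ball (f (S n)) (e / 2)) + mu (B n))%E; first apply: measureU.
  - exact: ball_borel.
  - exact: open_borel.
  - apply/seteqP; split => // z [+ [y yS yz]]; rewrite ballEmdist /= => fz.
    have [_ /(_ y yS)] := fP (S n).
    have := metric_triangle y z (f (S n)); rewrite (metric_sym z).
    by move: fz yz; lra.
  - rewrite -natr1 mulrDl mul1r addrC EFinD leeD//.
    by rewrite mE// lee_fin; apply: cP; have [] := fP (S n).
have {}muB n : n%:R * (T / C ^+ k) <= T.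
  rewrite -lee_fin; apply: (le_trans (muB n)).
  rewrite /T -mE ?addr_gt0//.
  by apply: le_measure => //; rewrite inE; [exact: open_borel|exact: ball_borel].
(* More than [C ^+ k] disjoint balls of measure at least [T / C ^+ k] do not fit into measure
   [T]. *)
have := muB (Num.truncn (C ^+ k)).+1.
rewrite mulrCA ger_pMr// ler_pdivrMr ?exprn_gt0// mul1r leNgt.
by rewrite truncnS_gt.
Qed.

Lemma doubling_compact x r : doubling mu -> 0 < r ->
  compact [set y | mdist x y <= r].
Proof.
move=> /doubling_constP[C C0 muC] r0; apply: totally_bounded_compact.
  move=> y /closure_mdist xy /=; apply/ler_addgt0Pr => e /xy[z /= xz yz].
  by have := metric_triangle x z y; rewrite (metric_sym z y); lra.
have r20 : 0 < 2 * r by rewrite mulr_gt0.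
move=> e /(doubling_totally_bounded x C0 muC r20)[s sP]; exists s => y /= xy.
by apply: sP; rewrite ballEmdist /=; lra.
Qed.

End doubling_measure.

(** * Means of bounded functions *)

Section mean_value.
Context d {T : measurableType d} {R : realType}.
Variable mu : {measure set T -> \bar R}.
Variables (v : T -> R) (N : R).
Hypotheses (mv : measurable_fun setT v) (vN : forall x, `|v x| <= N).
Implicit Types (A B : set T) (c : R).

Definition mean (f : T -> R) A : R := (fine (mu A))^-1 * \int[mu]_(x in A) f x.

Let pos_fin A := (0 < mu A < +oo)%E.

Lemma fine_measure_gt0 A : pos_fin A -> 0 < fine (mu A).
Proof. exact: fine_gt0. Qed.

Lemma bounded_integrable A : measurable A -> (mu A < +oo)%E ->
  mu.-integrable A (EFin \o v).
Proof.
move=> mA Aoo; apply: measurable_bounded_integrable => //.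
  exact: measurable_funTS.
exists N; split => [|e Ne x _]; first exact: num_real.
by apply: le_trans (ltW Ne); exact: vN.
Qed.

Lemma integrable_cst A c : measurable A -> (mu A < +oo)%E ->
  mu.-integrable A (EFin \o cst c).
Proof.
move=> mA Aoo; apply: measurable_bounded_integrable => //.
by exists `|c|; split => [|e ce x _]; [exact: num_real|exact: ltW].
Qed.

Lemma bounded_integrable_osc A c : measurable A -> (mu A < +oo)%E ->
  mu.-integrable A (EFin \o (fun x => `|v x - c|)).
Proof.
move=> mA Aoo; apply: measurable_bounded_integrable => //.
  apply: measurable_funTS; apply: measurableT_comp => //.
  exact: measurable_funB.
exists (N + `|c|); split => [|e Ne x _]; first exact: num_real.
rewrite /= normr_id; apply: le_trans (ltW Ne).
by apply: (le_trans (ler_normB _ _)); rewrite lerD2r.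
Qed.

Lemma le_mean_osc A c : measurable A -> pos_fin A ->
  `|mean v A - c| <= mean (fun x => `|v x - c|) A.
Proof.
move=> mA pA; have A0 := fine_measure_gt0 pA.
have /andP[_ Aoo] := pA.
have -> : mean v A - c = mean (fun x => v x - c) A.
  rewrite /mean RintegralB//; last 2 first.
  - exact: bounded_integrable.
  - exact: integrable_cst.
  by rewrite Rintegral_cst// mulrBr [c * _]mulrC mulKf// gt_eqF.
rewrite /mean normrM ger0_norm; last by rewrite invr_ge0 ltW.
rewrite ler_pM2l ?invr_gt0//.
apply: le_normr_Rintegral => //.
apply: (@eq_integrable _ _ _ mu A mA
  ((EFin \o v) \- (EFin \o cst c))%E) => [x _ //|].
apply: integrableB => //; first exact: bounded_integrable.
exact: integrable_cst.
Qed.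

Lemma mean_le A c e : measurable A -> pos_fin A ->
  (forall x, A x -> `|v x - c| <= e) -> mean (fun x => `|v x - c|) A <= e.
Proof.
move=> mA pA vce; have A0 := fine_measure_gt0 pA; have /andP[_ Aoo] := pA.
rewrite /mean mulrC ler_pdivrMr// -Rintegral_cst//.
apply: le_Rintegral => //; first exact: bounded_integrable_osc.
exact: integrable_cst.
Qed.

(** Passing from [A] to [B] enlarges the integral of [|v - c|], and the change of normalisation
    costs at most the factor [K]. This compares means over balls of comparable size. *)
Lemma mean_osc_subset A B c K : measurable A -> measurable B ->
  pos_fin A -> pos_fin B -> A `<=` B -> fine (mu B) <= K * fine (mu A) ->
  `|mean v A - c| <= K * mean (fun x => `|v x - c|) B.
Proof.
move=> mA mB pA pB AB BKA; apply: (le_trans (le_mean_osc c mA pA)).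
have A0 := fine_measure_gt0 pA; have B0 := fine_measure_gt0 pB.
have /andP[_ Aoo] := pA; have /andP[_ Boo] := pB.
rewrite /mean mulrA; apply: ler_pM.
- by rewrite invr_ge0 ltW.
- exact: Rintegral_ge0.
- by rewrite -(ler_pM2r B0) divfK ?gt_eqF// ler_pdivrMl// mulrC.
- rewrite /Rintegral fine_le//.
  + exact/integrable_fin_num/bounded_integrable_osc.
  + exact/integrable_fin_num/bounded_integrable_osc.
  + apply: ge0_subset_integral => //.
    by have /integrableP[] := bounded_integrable_osc c mB Boo.
Qed.

End mean_value.

(** Every simple function below the indicator of [A] is below [f] on [D]. Comparing suprema over
    simple functions allows [f] to be a composition with a curve, whose measurability is not
    established. *)
Lemma le_integral_ge1 d (T : measurableType d) (R : realType)
    (mu : {measure set T -> \bar R}) (D A : set T) (f : T -> \bar R) :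
  measurable A -> A `<=` D -> (forall x, (0 <= f x)%E) ->
  (forall x, A x -> (1 <= f x)%E) -> (mu A <= \int[mu]_(x in D) f x)%E.
Proof.
move=> mA AD f0 f1.
have -> : mu A = (\int[mu]_x (\1_A x)%:E)%E.
  by rewrite integral_indic// setIT.
rewrite !ge0_integralE//.
apply: ereal_sup_le => [_ [h hA <-]]; exists h => // x.
apply: (le_trans (hA x)); rewrite patchT ?inE// indicE.
have [/set_mem Ax|_] := boolP (x \in A); last exact: erestrict_ge0.
by rewrite patchT ?inE; [exact: f1|exact: AD].
Qed.

(** * The height function of a jump component and its upper gradient *)

Section jump_height.
Context {R : realType} {X : completeMetricType R}.
Variables (x0 : X) (r e : R).
Hypotheses (r0 : 0 < r) (e0 : 0 < e).

Let J := jump_component (ball x0 r) e x0.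

Definition jump_height (z : X) : R := if z \in J then r - mdist x0 z else 0.

Let v := jump_height.

Let JU z : J z -> mdist x0 z < r.
Proof.
have x0U : ball x0 r x0 by exact: ballxx.
by move=> /(jump_component_sub x0U); rewrite ballEmdist.
Qed.

Lemma jump_height_ge0 z : 0 <= v z.
Proof.
rewrite /v /jump_height; case: ifPn => // /set_mem /JU.
by rewrite subr_ge0 => /ltW.
Qed.

Lemma jump_height_le z : v z <= r.
Proof.
rewrite /v /jump_height; case: ifPn => _; last exact: ltW.
by rewrite gerBl mdist_ge0.
Qed.

Lemma jump_height_gt0 z : 0 < v z -> v z = r - mdist x0 z.
Proof. by rewrite /v /jump_height; case: ifPn; rewrite ?ltxx. Qed.

Lemma jump_height_supp z : ~ ball x0 r z -> v z = 0.
Proof.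
rewrite ballEmdist /v /jump_height /= => zU; case: ifPn => // /set_mem /JU.
by move/zU.
Qed.

(** Inside [J] this is the triangle inequality. A jump shorter than [e] leaves [J] only by leaving
    [ball x0 r], and there [r - mdist x0 w] has already dropped to 0 or below. *)
Lemma jump_height_lip z w : mdist z w < e -> `|v z - v w| <= mdist z w.
Proof.
wlog vwz : z w / v w <= v z.
  move=> wl; have [/wl//|/ltW /wl h] := leP (v w) (v z).
  by rewrite metric_sym distrC; exact: h.
move=> zw; rewrite ger0_norm ?subr_ge0//.
have [vz|] := ltP 0 (v z); last first.
  have := jump_height_ge0 w; rewrite -/(v w); have := mdist_ge0 z w.
  by move: vwz; lra.
rewrite (jump_height_gt0 vz); have zw3 := metric_triangle x0 z w.
have [vw|vw0] := ltP 0 (v w).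
  by rewrite (jump_height_gt0 vw); move: zw3; lra.
have := jump_height_ge0 w; rewrite -/(v w) => vw.
suff : r <= mdist x0 w by move: zw3 vw; lra.
rewrite leNgt; apply/negP => xw.
have Jw : J w.
  apply: (@jump_component_step _ _ _ _ _ z) => //; last by rewrite ballEmdist.
  move: vz; rewrite /v /jump_height; case: ifPn; rewrite ?ltxx//.
  by move=> /set_mem.
by move: vw0; rewrite /v /jump_height mem_set//; move: xw; lra.
Qed.

Lemma jump_height_center : v x0 = r.
Proof.
rewrite /v /jump_height mem_set ?mdistxx ?subr0//.
Qed.

(** The Lipschitz bound at scale [e] makes the superlevel sets open. *)
Lemma jump_height_measurable :
  measurable_fun [set: borel X] (jump_height : borel X -> R).
Proof.
move=> mT; apply: (measurability _ (RGenOInfty.measurableE R)) => //.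
move=> /= _ [_ [a ->] <-]; apply: measurableI => //; apply: open_borel.
apply/open_mdist => z; rewrite /= in_itv /= andbT => az.
exists (Num.min e (v z - a)); first by rewrite lt_min e0 subr_gt0.
move=> w; rewrite lt_min => /andP[zw vzw].
rewrite /= in_itv /= andbT.
have := jump_height_lip zw; rewrite -/(v w) ler_norml.
by move: vzw; lra.
Qed.

Lemma arc_length_lip (c : R * (R -> X)) s t : arc_length_curve c ->
  0 <= s -> s <= t -> t <= c.1 -> mdist (c.2 s) (c.2 t) <= t - s.
Proof.
move=> [_ cE] s0 st tc; rewrite -lee_fin -cE//.
apply: ereal_sup_ubound; exists [:: t] => /=; first by rewrite st.
by rewrite /curve_variation big_ord1.
Qed.

(** The Lipschitz bound is only local, so the curve is halved until its pieces are shorter than [e];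
    [n] counts the halvings. *)
Lemma jump_height_curve (c : R * (R -> X)) s t : arc_length_curve c ->
  0 <= s -> s <= t -> t <= c.1 -> `|v (c.2 s) - v (c.2 t)| <= t - s.
Proof.
move=> ac; have [n] : exists n : nat, t - s < 2 ^+ n * e.
  exists (Num.truncn ((t - s) / e)).+1; rewrite -ltr_pdivrMr//.
  apply: lt_le_trans (truncnS_gt _) _.
  by rewrite -natrX ler_nat ltnW// ltn_expl.
elim: n s t => [|n IHn] s t; rewrite ?expr0 ?mul1r => tse s0 st tc.
  have := arc_length_lip ac s0 st tc => ctc; apply: le_trans ctc.
  by apply: jump_height_lip; apply: le_lt_trans tse; exact: arc_length_lip.
pose m := (s + t) / 2; move: tse; rewrite exprS -mulrA => tse.
have h1 : m - s < 2 ^+ n * e by rewrite /m; lra.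
have h2 : t - m < 2 ^+ n * e by rewrite /m; lra.
have := IHn _ _ h1 s0; have := IHn _ _ h2.
move=> H2 H1; rewrite (_ : t - s = (m - s) + (t - m)); last by lra.
apply: (le_trans (ler_distD (v (c.2 m)) _ _)); apply: lerD.
  by apply: H1; rewrite /m; lra.
by apply: H2; rewrite /m; lra.
Qed.

(** Let [h] be the difference of the heights at the ends of a curve. The higher end is at distance
    at least [h] from the complement of [ball x0 r], so the curve spends at least the length [h] in
    the ball. *)
Lemma jump_height_upper_gradient :
  upper_gradient (EFin \o jump_height) (EFin \o \1_(ball x0 r)).
Proof.
split.
  split; last by move=> x; rewrite lee_fin.
  by apply/measurable_EFinP; apply: measurable_indic; exact: ball_borel.
move=> c ac; rewrite /upper_gradient_ineq /=.
have [c0 _] := ac; rewrite -/v.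
have lip := jump_height_curve ac (lexx _) (ltW c0) (lexx _).
rewrite subr0 in lip.
pose h := `|v (c.2 0) - v (c.2 c.1)|.
suff [A [mA AD muA cA]] : exists A : set R, [/\ measurable A,
    A `<=` `[0, c.1]%classic, lebesgue_measure A = h%:E &
    forall t, A t -> ball x0 r (c.2 t)].
  rewrite -/h -muA; apply: le_integral_ge1 => // [t|t At].
    by rewrite /= lee_fin.
  by rewrite /= indicE mem_set//; exact: cA.
(* The interval [A] has length [h] and is adjacent to the end where the height is larger. *)
have [v0|v0] := leP (v (c.2 c.1)) (v (c.2 0)).
- have hE : h = v (c.2 0) - v (c.2 c.1) by rewrite /h ger0_norm// subr_ge0.
  exists `[0, h[%classic; split => //.
  + by move=> t /=; rewrite !in_itv /= => /andP[-> th]; move: th lip; rewrite -/h; lra.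
  + rewrite lebesgue_measure_itv /= lte_fin sube0.
    case: ltP => // h0; congr (_%:E).
    by apply/eqP; rewrite eq_le h0 /h normr_ge0.
  + move=> t /=; rewrite in_itv /= => /andP[t0 th].
    have tc : t <= c.1 by move: th lip; rewrite -/h; lra.
    have := arc_length_lip ac (lexx _) t0 tc.
    have := jump_height_ge0 (c.2 c.1); rewrite -/(v _) => vc.
    have /jump_height_gt0 : 0 < v (c.2 0) by move: th t0; rewrite hE; lra.
    rewrite -/(v _) ballEmdist /=; have := metric_triangle x0 (c.2 0) (c.2 t).
    by move: th vc; rewrite hE; lra.
- have hE : h = v (c.2 c.1) - v (c.2 0).
    by rewrite /h ltr0_norm ?subr_lt0// opprB.
  exists `]c.1 - h, c.1]%classic; split => //.
  + move=> t /=; rewrite !in_itv /= => /andP[th ->]; rewrite andbT.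
    by move: th lip; rewrite -/h; lra.
  + rewrite lebesgue_measure_itv /= lte_fin ltrBlDr ltrDl.
    case: ifPn => [_|]; first by rewrite -EFinB; congr (_%:E); lra.
    by rewrite hE subr_gt0 v0.
  + move=> t /=; rewrite in_itv /= => /andP[th tc].
    have t0 : 0 <= t by move: th lip; rewrite -/h; lra.
    have := arc_length_lip ac t0 tc (lexx _).
    have := jump_height_ge0 (c.2 0); rewrite -/(v _) => vc.
    have /jump_height_gt0 : 0 < v (c.2 c.1) by move: v0 vc; lra.
    rewrite -/(v _) ballEmdist /=; have := metric_triangle x0 (c.2 c.1) (c.2 t).
    rewrite (metric_sym (c.2 t)).
    by move: th vc; rewrite hE; lra.
Qed.

End jump_height.

(** * Mean oscillation of the height function *)

Lemma Lp_energy_bounded_support {R : realType} {X : completeMetricType R}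
    (mu : {measure set (borel X) -> \bar R}) (p c : R) (B : set X)
    (f : X -> \bar R) : 0 < p -> 0 <= c ->
  measurable (B : set (borel X)) -> (mu B < +oo)%E ->
  measurable_fun [set: borel X] (f : borel X -> \bar R) ->
  (forall x, B x -> `|f x| <= c%:E)%E -> (forall x, ~ B x -> f x = 0%E) ->
  (Lp_energy mu p f < +oo)%E.
Proof.
move=> p0 c0 mB muB mf fB f0.
apply: (@le_lt_trans _ _ (\int[mu]_(x in setT) (c `^ p * \1_B x)%:E)%E).
  apply: ge0_le_integral => //.
  - by move=> x _; exact: poweR_ge0.
  - apply: (measurableT_comp (measurable_poweR p)).
    exact: measurableT_comp.
  - apply/measurable_EFinP; apply: measurable_funM => //.
  - move=> x _; have [Bx|nBx] := pselect (B x).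
      rewrite indicE mem_set// mulr1 -poweR_EFin; apply: gt0_ler_poweR (fB x Bx).
      + exact: ltW.
      + by rewrite in_itv /= leey andbT.
      + by rewrite in_itv /= leey andbT lee_fin.
    rewrite f0// abse0 poweR0r ?gt_eqF// lee_fin.
    by rewrite mulr_ge0 ?powR_ge0.
under eq_integral do rewrite EFinM.
rewrite ge0_integralZl//.
- by rewrite integral_indic// setIT lte_mul_pinfty// lee_fin powR_ge0.
- by apply/measurable_EFinP; exact: measurable_indic.
- by rewrite lee_fin powR_ge0.
Qed.

Section poincare_oscillation.
Context {R : realType} {X : completeMetricType R}.
Variable mu : {measure set (borel X) -> \bar R}.
Variable p : R.
Hypotheses (p1 : 1 <= p) (mu_ball : finite_positive_on_balls mu).

Let p0 : 0 < p. Proof. exact: lt_le_trans p1. Qed.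

Lemma newtonian_jump_height x0 (r e : R) : 0 < r -> 0 < e ->
  newtonian mu p (EFin \o jump_height x0 r e).
Proof.
move=> r0 e0.
have mv := @jump_height_measurable _ X x0 _ _ r0 e0.
have mB := @ball_borel _ X x0 r.
have /andP[_ muB] := mu_ball x0 r0.
split.
  exists (EFin \o jump_height x0 r e); split; first exact/measurable_EFinP.
  exact: aeW.
rewrite lte_add_pinfty//.
  apply: (Lp_energy_bounded_support p0 (ltW r0) mB muB).
  - exact/measurable_EFinP.
  - move=> x _; rewrite /= lee_fin ger0_norm ?jump_height_ge0//.
    exact: jump_height_le.
  - by move=> x Bx; rewrite /= jump_height_supp.
apply: (@le_lt_trans _ _ (Lp_energy mu p (EFin \o \1_(ball x0 r)))).
  apply: ereal_inf_lbound; exists (EFin \o \1_(ball x0 r)) => //.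
  exact: jump_height_upper_gradient.
apply: (Lp_energy_bounded_support p0 ler01 mB muB).
- by apply/measurable_EFinP; exact: measurable_indic.
- by move=> x Bx; rewrite /= indicE mem_set// normr1.
- by move=> x nBx; rewrite /= indicE memNset.
Qed.

(** The minimal weak upper gradient is at most the indicator of a ball, hence at most 1 almost
    everywhere, so [C] depends on neither [r] nor [e]; a factor 2 in it comes from the diameter of
    the ball. The variable [v] gives the height function the type [borel X -> R], over which it can
    be integrated. *)
Lemma poincare_jump_height : poincare mu p -> exists2 C : R, 0 < C &
  forall x0 (r e : R), 0 < r -> 0 < e ->
  forall x (s : R), 0 < s -> forall v : borel X -> R, v = jump_height x0 r e ->
    mean mu (fun y => `|v y - mean mu v (ball x s)|) (ball x s) <= C * s.
Proof.
move=> [C [lambda [C0 lam1 P]]]; exists (C * 2); first by rewrite mulr_gt0.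
move=> x0 r e r0 e0 x s s0 _ ->.
have /P[g [wg gfin gmin] Pg] := newtonian_jump_height x0 r0 e0.
have := Pg x s s0; rewrite /average.
set v : borel X -> R := jump_height x0 r e.
have mv := @jump_height_measurable _ X x0 _ _ r0 e0.
have vr y : `|v y| <= r.
  by rewrite ger0_norm ?jump_height_ge0//; exact: jump_height_le.
have mB y t := @ball_borel _ X y t.
have /andP[muB0 muB] := mu_ball x s0.
have intv : (\int[mu]_(y in ball x s) (EFin \o v) y)%E =
    (\int[mu]_(y in ball x s) v y)%:E.
  rewrite /Rintegral fineK//; apply: integrable_fin_num => //.
  exact: (bounded_integrable mv vr).
rewrite intv -EFinM -/(mean mu v (ball x s)).
under eq_integral do rewrite -EFinB abse_EFin.
have -> : (\int[mu]_(y in ball x s) `|v y - mean mu v (ball x s)|%:E)%E =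
    (\int[mu]_(y in ball x s) `|v y - mean mu v (ball x s)|)%:E.
  rewrite /Rintegral fineK//; apply: integrable_fin_num => //.
  exact: (bounded_integrable_osc mv vr).
rewrite -EFinM -/(mean _ _ _) => H.
rewrite -lee_fin; apply: (le_trans H).
have ls : 0 < lambda * s by rewrite mulr_gt0// (lt_le_trans _ lam1).
have /andP[muL0 muL] := mu_ball x ls.
have [mg g0] : nneg_borel g by case: wg.
(* Minimality is applied to the indicator, an upper gradient and thus a weak one with empty
   exceptional family. *)
have g1 : {ae mu, forall y, (g y <= (EFin \o \1_(ball x0 r)) y)%E}.
  apply: gmin.
    have [? ?] := @jump_height_upper_gradient _ X x0 _ _ r0 e0; split => //.
    exists set0; split => // [|c ac _]; last by auto.
    exists (cst 0%E); split => //.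
    rewrite /Lp_energy.
    under eq_integral do rewrite abse0 poweR0r ?gt_eqF//.
    by rewrite integral0.
  have /andP[_ mu0] := mu_ball x0 r0.
  apply: (Lp_energy_bounded_support p0 ler01 (mB x0 r) mu0).
  - by apply/measurable_EFinP; exact: measurable_indic.
  - by move=> y By; rewrite /= indicE mem_set// normr1.
  - by move=> y nBy; rewrite /= indicE memNset.
have avg1 : ((((fine (mu (ball x (lambda * s))))^-1)%:E *
    \int[mu]_(y in ball x (lambda * s)) (g y `^ p)) <= 1)%E.
  rewrite -[leRHS](_ : ((fine (mu (ball x (lambda * s))))^-1)%:E *
    mu (ball x (lambda * s)) = 1)%E; last first.
    rewrite -[X in (_ * X)%E]fineK; last by rewrite ge0_fin_numE// ltW.
    by rewrite -EFinM mulVf// gt_eqF// fine_gt0// muL0.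
  apply: lee_wpmul2l.
    by rewrite lee_fin invr_ge0 fine_ge0// ltW.
  rewrite -[leRHS]mul1e -integral_cst//.
  apply: ae_ge0_le_integral => //.
  - by move=> y _; exact: poweR_ge0.
  - apply: measurable_funTS; exact: (measurableT_comp (measurable_poweR p)).
  - have [N [mN N0 gN]] := g1; exists N; split => //.
    apply: subset_trans gN; apply: subsetC => y /= gy _.
    rewrite -[leRHS](poweR1r p); apply: gt0_ler_poweR.
    + exact: ltW.
    + by rewrite in_itv /= leey andbT.
    + by rewrite in_itv /= leey andbT lee_fin.
    + by apply: (le_trans gy); rewrite /= lee_fin indicE; case: (_ \in _).
have diamB : (diam (ball x s) <= (2 * s)%:E)%E.
  apply: ge_ereal_sup => _ [y + [z + <-]]; rewrite !ballEmdist /= => xy xz.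
  by rewrite lee_fin; have := metric_triangle y x z; rewrite (metric_sym y x); lra.
have diam0 : (0 <= diam (ball x s))%E.
  apply: ereal_sup_ubound; exists x; first exact: ballxx.
  by exists x; [exact: ballxx|rewrite mdistxx].
rewrite -[leRHS]mule1; apply: lee_pmul.
- by rewrite mule_ge0// lee_fin ltW.
- exact: poweR_ge0.
- by rewrite -mulrA [leRHS]EFinM lee_pmul2l// lte_fin.
- rewrite -[leRHS](poweR1r p^-1); apply: gt0_ler_poweR => //.
  + by rewrite invr_ge0 ltW.
  + rewrite in_itv /= leey andbT mule_ge0//.
    by apply: integral_ge0 => y _; exact: poweR_ge0.
  + by rewrite in_itv /= leey andbT lee_fin.
Qed.

End poincare_oscillation.

(** * Local connectedness of [X] *)

Section local_connectedness.
Context {R : realType} {X : completeMetricType R}.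
Variables (mu : {measure set (borel X) -> \bar R}) (p : R).
Hypotheses (p1 : 1 <= p) (mu_ball : finite_positive_on_balls mu).
Hypotheses (mu_doubling : doubling mu) (mu_poincare : poincare mu p).

(* The height function of a jump component oscillates at most linearly, with
   a constant that does not depend on the jump length [e]: compare its values
   at two points through its means over dyadic balls. *)
Lemma jump_component_ball : exists2 L : R, 0 < L &
  forall (x0 : X) (r e : R), 0 < r -> 0 < e ->
  forall y, mdist x0 y < r / L -> jump_component (ball x0 r) e x0 y.
Proof.
have [C C0 muC] := poincare_jump_height p1 mu_ball mu_poincare.
have [D D0 muD] := doubling_constP mu_ball mu_doubling.
pose E := 2 * D * C + 1.
have DC0 : 0 < D * C by rewrite mulr_gt0.
have D2C0 : 0 < D ^+ 2 * C by rewrite mulr_gt0// exprn_gt0.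
pose L := 3 * E + 2 * (D ^+ 2 * C).
have E0 : 0 < E by rewrite /E -mulrA; lra.
have L0 : 0 < L by rewrite /L; lra.
exists L => // x0 r e r0 e0 y; rewrite ltr_pdivlMr// => yr.
pose v : borel X -> R := jump_height x0 r e.
have mv : measurable_fun setT v by exact: jump_height_measurable.
have vr z : `|v z| <= r.
  by rewrite ger0_norm ?jump_height_ge0//; exact: jump_height_le.
pose a x s := mean mu v (ball x s).
have mB x s := @ball_borel _ X x s.
have osc_le x s t z K : 0 < s -> 0 < t -> ball z t `<=` ball x s ->
    fine (mu (ball x s)) <= K * fine (mu (ball z t)) -> 0 < K ->
    `|a z t - a x s| <= K * (C * s).
  move=> s0 t0 ts stK K0.
  have := mean_osc_subset mv vr (a x s) (mB z t) (mB x s) (mu_ball z t0)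
    (mu_ball x s0) ts stK.
  move=> /le_trans; apply; rewrite ler_pM2l//.
  exact: (muC x0 r e r0 e0 x s s0 v erefl).
(* Induction on the number of halvings that bring [s] below [e], where the Lipschitz bound applies.
   One halving costs [D * C * s], and [E / 2 + D * C <= E] by the choice of [E]. *)
have tele n : forall x s, 0 < s -> s < 2 ^+ n * e -> `|v x - a x s| <= E * s.
  elim: n => [|n IHn] x s s0; rewrite ?expr0 ?mul1r ?exprS => se.
    rewrite distrC.
    apply: (le_trans (le_mean_osc mv vr _ (mB x s) (mu_ball x s0))).
    apply: (@le_trans _ _ s); last first.
      by apply: ler_peMl; [exact: ltW|rewrite /E -mulrA; lra].
    apply: (mean_le mv vr (mB x s) (mu_ball x s0)) => z.
    rewrite ballEmdist /= => xz; rewrite distrC.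
    apply: le_trans (ltW xz); apply: jump_height_lip => //.
    exact: lt_trans se.
  have s20 : 0 < s / 2 by rewrite divr_gt0.
  have h1 : `|v x - a x (s / 2)| <= E * (s / 2).
    by apply: IHn => //; move: se; rewrite -mulrA; lra.
  have h2 : `|a x (s / 2) - a x s| <= D * (C * s).
    apply: osc_le => //.
      move=> z; rewrite !ballEmdist /= => xz; lra.
    rewrite [X in ball x X](_ : s = 2 * (s / 2)); last by lra.
    exact: muD.
  apply: (le_trans (ler_distD (a x (s / 2)) _ _)).
  apply: (le_trans (lerD h1 h2)).
  have s0' := ltW s0; have : 0 <= D * C * s by rewrite mulr_ge0// ltW.
  by rewrite /E !mulrDl !mul1r -!mulrA; lra.
have {}tele x s : 0 < s -> `|v x - a x s| <= E * s.
  move=> s0; apply: (tele (Num.truncn (s / e)).+1) => //.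
  rewrite -ltr_pdivrMr//; apply: lt_le_trans (truncnS_gt _) _.
  by rewrite -natrX ler_nat ltnW// ltn_expl.
have [->|/eqP yx] := pselect (y = x0); first exact: jump_component_refl.
(* If [y] is not reached, the height drops from [r] at [x0] to 0 at [y]. Going through the means
   over [ball x0 (2 * d)] and [ball y d] bounds this drop by [L * d], which is less than [r]. *)
apply: contrapT => Jy; pose d := mdist x0 y.
have d0 : 0 < d by rewrite mdist_gt0 eq_sym.
have vy : v y = 0 by rewrite /v /jump_height memNset.
have vx : v x0 = r by exact: jump_height_center.
have d20 : 0 < 2 * d by rewrite mulr_gt0.
have := tele y d d0; have := tele x0 (2 * d) d20.
(* [ball x0 (2 * d)] contains [ball y d] and lies in [ball y (4 * d)], whence the factor
   [D ^+ 2]. *)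
have : `|a y d - a x0 (2 * d)| <= D ^+ 2 * (C * (2 * d)).
  apply: osc_le => //; last by rewrite exprn_gt0.
    move=> z; rewrite !ballEmdist /= => yz.
    by have := metric_triangle x0 y z; rewrite -/d; lra.
  apply: le_trans (doubling_iter y 2 D0 muD d0).
  have d40 : 0 < 2 ^+ 2 * d by rewrite mulr_gt0// exprn_gt0.
  apply: fine_le.
  - by rewrite ge0_fin_numE//; have /andP[] := mu_ball x0 d20.
  - by rewrite ge0_fin_numE//; have /andP[] := mu_ball y d40.
  apply: le_measure; rewrite ?inE//.
  move=> z; rewrite !ballEmdist /= => xz.
  have := metric_triangle y x0 z; rewrite (metric_sym y x0) -/d expr2.
  by move: xz; lra.
rewrite vy vx sub0r normrN !ler_norml => H1 H2 H3.
move: yr; rewrite -/d /L.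
have -> : d * (3 * E + 2 * (D ^+ 2 * C)) =
  E * d + E * (2 * d) + D ^+ 2 * (C * (2 * d)) by ring.
by move: H1 H2 H3; lra.
Qed.

Lemma poincare_locally_connected (x : X) (r : R) : 0 < r ->
  exists2 d : R, 0 < d & forall y, mdist x y < d ->
    exists C : set X, [/\ connected C, C `<=` ball x r, C x & C y].
Proof.
(* Half the radius, so that the compact closed ball lies in the open ball of radius [r]. *)
move=> r0; have r20 : 0 < r / 2 by rewrite divr_gt0.
have [L L0 JL] := jump_component_ball.
have cK := doubling_compact mu_ball mu_doubling r20.
exists (r / 2 / L); first by rewrite divr_gt0.
have Kx : [set y | mdist x y <= r / 2] x by rewrite /= mdistxx ltW.
move=> y xy; eexists; split; first exact: (compact_jump_connected (cK x) Kx).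
- move=> z /(_ 1 ltr01) /(jump_component_sub Kx) /=.
  by rewrite ballEmdist /=; lra.
- by move=> e _; exact: jump_component_refl.
- move=> e e0; have := JL x _ _ r20 e0 y xy; apply: le_jump_component => // z.
  by rewrite ballEmdist /= => /ltW.
Qed.

End local_connectedness.

(** Used with [f] sending a point to its component: finitely many components yield a finite list of
    points meeting each of them. [{classic S}] supplies decidable equality on the values. *)
Lemma finite_image_representatives (T : eqType) (S : Type) (f : T -> S)
    (A : set T) : finite_set (f @` A) ->
  exists2 s : seq T, (forall z, z \in s -> A z) &
    forall x, A x -> exists2 z, z \in s & f x = f z.
Proof.
move=> fA; have [s sE] := (@finite_seqP {classic S} _).1 fA.
have [[a Aa]|A0] := pselect (A !=set0); last first.
  by exists [::] => // x Ax; exfalso; apply: A0; exists x.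
have /choice[g gP] : forall b : S, exists z, A z /\ ((f @` A) b -> f z = b).
  move=> b; have [[z Az zb]|nb] := pselect ((f @` A) b); first by exists z.
  by exists a.
exists [seq g b | b <- s] => [z|x Ax].
  by move=> /(@mapP {classic S})[b _ ->]; have [] := gP b.
have fx : (f @` A) (f x) by exists x.
exists (g (f x)); last by have [_ ->] := gP (f x).
by apply: (@map_f {classic S}); move: fx; rewrite sE.
Qed.

(** * Compactness of the completion and its projection to [X] *)

Section mazurkiewicz_completion_theory.
Context {R : realType} {X : completeMetricType R}.
Variables (Omega : set X) (M : completeMetricType R) (iota : Omega -> M).
Hypotheses (Omega_domain : bounded_domain Omega)
  (iotaP : mazurkiewicz_completion iota).
Hypothesis proper_X : forall (x : X) (r : R), 0 < r ->
  compact [set y | mdist x y <= r].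
Hypothesis lc_X : forall (x : X) (r : R), 0 < r ->
  exists2 d : R, 0 < d & forall y, mdist x y < d ->
    exists C : set X, [/\ connected C, C `<=` ball x r, C x & C y].
Hypothesis fc_Omega : finitely_connected_at_boundary Omega.
Implicit Types (x y z w : Omega) (m : M) (C : set X).

Lemma set_valX x : Omega (set_val x).
Proof. exact: set_valP. Qed.

Lemma set_val_ex (a : X) : Omega a -> exists x, set_val x = a.
Proof. by move=> Oa; exists (exist _ a (mem_set Oa)). Qed.

Lemma Omega_open : open Omega.
Proof. by case: Omega_domain. Qed.

Lemma boundary_Omega (a : X) : boundary Omega a -> ~ Omega a.
Proof.
move=> [_ nia] Oa; by apply: nia; rewrite ((interior_id _).1 Omega_open).
Qed.

Let diam_ge0 (A : set X) a : A a -> (0 <= diam A)%E.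
Proof.
by move=> Aa; apply: ereal_sup_ubound; exists a => //; exists a; rewrite ?mdistxx.
Qed.

Let diam_le (A : set X) (b : R) :
  (forall a c, A a -> A c -> mdist a c <= b) -> (diam A <= b%:E)%E.
Proof. by move=> Ab; apply: ge_ereal_sup => _ [a Aa [c Ac <-]]; rewrite lee_fin Ab. Qed.

Let mdist_le_diam (A : set X) a c : A a -> A c -> ((mdist a c)%:E <= diam A)%E.
Proof. by move=> Aa Ac; apply: ereal_sup_ubound; exists a => //; exists c. Qed.

Let joining x y := [set C : set X |
  [/\ connected C, C `<=` Omega, C (set_val x) & C (set_val y)]].

(** [Omega] itself joins any two of its points and is bounded, so the infimum is finite and [fine]
    loses nothing. *)
Let inf_joining x y : ereal_inf (diam @` joining x y) =
  (mdist (iota x) (iota y))%:E.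
Proof.
have [iE _] := iotaP; rewrite iE /mazurkiewicz fineK// ge0_fin_numE.
  have [_ _ cO dO] := Omega_domain; apply: le_lt_trans dO.
  apply: ereal_inf_lbound; exists Omega => //.
  by split => //; exact: set_valX.
by apply: le_ereal_inf_tmp => _ [C [_ _ Cx _] <-]; exact: diam_ge0 Cx.
Qed.

Lemma mdist_iota_le x y C (b : R) : connected C -> C `<=` Omega ->
  C (set_val x) -> C (set_val y) ->
  (forall a c, C a -> C c -> mdist a c <= b) -> mdist (iota x) (iota y) <= b.
Proof.
move=> cC CO Cx Cy Cb; rewrite -lee_fin -inf_joining.
by apply: le_trans (diam_le Cb); apply: ereal_inf_lbound; exists C.
Qed.

Lemma mdist_iota_lt x y (b : R) : mdist (iota x) (iota y) < b ->
  exists2 C, joining x y C & forall a c, C a -> C c -> mdist a c < b.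
Proof.
rewrite -lte_fin -inf_joining => /ereal_inf_lt[_ [C jC <-]] Cb; exists C => //.
move=> a c Ca Cc; rewrite -lte_fin; apply: le_lt_trans Cb.
exact: mdist_le_diam.
Qed.

Lemma mdist_le_iota x y : mdist (set_val x) (set_val y) <= mdist (iota x) (iota y).
Proof.
apply/ler_addgt0Pr => e e0.
have /mdist_iota_lt[C [_ _ Cx Cy] Cb] :
  mdist (iota x) (iota y) < mdist (iota x) (iota y) + e by rewrite ltrDl.
exact/ltW/Cb.
Qed.

Lemma iota_dense m (e : R) : 0 < e -> exists x, mdist (iota x) m < e.
Proof.
move=> e0; have [_ /(_ (ball m e))] := iotaP.
case; [by exists m; exact: ballxx|exact: mdist_ball_open|].
by move=> m' [+ [x _ xm']]; rewrite -xm' ballEmdist /= metric_sym; exists x.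
Qed.

(** By local connectedness, nearby points are joined by a connected set within a small ball
    contained in [Omega]. *)
Lemma iota_continuous x (e : R) : 0 < e -> exists2 d : R, 0 < d &
  forall y, mdist (set_val x) (set_val y) < d -> mdist (iota x) (iota y) < e.
Proof.
move=> e0; have [d d0 dO] := (open_mdist _).1 Omega_open _ (set_valX x).
pose r := Num.min d (e / 4).
have r0 : 0 < r by rewrite lt_min d0 divr_gt0.
have rd : r <= d by rewrite ge_min lexx.
have re : r <= e / 4 by rewrite ge_min lexx orbT.
have [d' d'0 d'P] := lc_X (set_val x) r0.
exists d' => // y /d'P[C [cC Cr Cx Cy]].
apply: (@le_lt_trans _ _ (2 * r)); last by move: r0 re; lra.
apply: (mdist_iota_le cC) => //.
  move=> a /Cr; rewrite ballEmdist /= => xa; apply: dO.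
  exact: lt_le_trans rd.
move=> a c /Cr + /Cr; rewrite !ballEmdist /= => xa xc.
by have := metric_triangle a (set_val x) c; rewrite (metric_sym a (set_val x)); lra.
Qed.

(** At a point of [Omega] this is the continuity of [iota]. At a boundary point, finite
    connectedness gives a neighbourhood whose trace on [Omega] has finitely many components, each of
    Mazurkiewicz diameter at most [e / 2]. *)
Lemma Omega_locally_small (a : X) (e : R) : closure Omega a -> 0 < e ->
  exists G : set X, [/\ open G, G a & exists s : seq M, forall x,
    G (set_val x) -> exists2 m, m \in s & mdist m (iota x) < e].
Proof.
move=> cla e0; have [Oa|nOa] := pselect (Omega a).
  have [x xa] := set_val_ex Oa; have [d d0 dP] := iota_continuous x e0.
  exists (ball a d); split; [exact: mdist_ball_open|exact: ballxx|].
  exists [:: iota x] => y; rewrite ballEmdist -xa /= => /dP xy.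
  by exists (iota x); rewrite ?mem_head.
have ba : boundary Omega a by split => // /interior_subset.
have e40 : 0 < e / 4 by rewrite divr_gt0.
have [G [oG Ga Gr fG]] := fc_Omega ba e40.
exists G; split => //.
pose f x := connected_component (G `&` Omega) (set_val x).
have [s sG Gs] : exists2 s : seq Omega, (forall z, z \in s -> G (set_val z)) &
    forall x, G (set_val x) -> exists2 z, z \in s & f x = f z.
  apply: (@finite_image_representatives _ _ f [set x | G (set_val x)]).
  apply: sub_finite_set fG => _ [x Gx <-]; exists (set_val x) => //.
  by split => //; exact: set_valX.
exists (map iota s) => y Gy; have [z zs cE] := Gs y Gy.
exists (iota z); first exact: map_f.
have Cy : f z (set_val y).
  by rewrite -cE; apply: connected_component_refl; split => //; exact: set_valX.
apply: (@le_lt_trans _ _ (2 * (e / 4))); last by move: e0; lra.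
apply: (mdist_iota_le (@component_connected _ (G `&` Omega) (set_val z))) => //.
- by move=> b /connected_component_sub[].
- by apply: connected_component_refl; split; [exact: sG|exact: set_valX].
- move=> b c /connected_component_sub[/Gr + _] /connected_component_sub[/Gr + _].
  rewrite !ballEmdist /= => ab ac.
  by have := metric_triangle b a c; rewrite (metric_sym b a); lra.
Qed.

(** Finitely many of the neighbourhoods above cover the compact closure of [Omega]; their lists
    together form an [e / 2]-net of the image of [Omega], which is dense. *)
Lemma completion_compact : compact [set: M].
Proof.
apply: totally_bounded_compact; first exact: closedT.
move=> e e0; have e20 : 0 < e / 2 by rewrite divr_gt0.
have [[a0 Oa0] _ _ dO] := Omega_domain.
have cO : compact (closure Omega).
  have [b b0 Ob] : exists2 b : R, 0 < b & forall a, Omega a -> mdist a0 a <= b.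
    exists (fine (diam Omega) + 1).
      by rewrite ltr_wpDl// fine_ge0//; exact: diam_ge0 Oa0.
    move=> a Oa; have := mdist_le_diam Oa0 Oa.
    have : diam Omega \is a fin_num.
      by rewrite ge0_fin_numE//; exact: diam_ge0 Oa0.
    move=> /fineK <-; rewrite lee_fin => /le_trans; apply.
    by rewrite lerDl.
  apply: (subclosed_compact _ (@proper_X a0 b b0)); first exact: closed_closure.
  move=> a /closure_mdist cla /=; apply/ler_addgt0Pr => d /cla[c /Ob a0c ac].
  by have := metric_triangle a0 c a; rewrite (metric_sym c a); lra.
have /choice[G GP] : forall a, exists G : set X, closure Omega a ->
    [/\ open G, G a & exists s : seq M, forall x,
    G (set_val x) -> exists2 m, m \in s & mdist m (iota x) < e / 2].
  move=> a; have [cla|ncla] := pselect (closure Omega a); last by exists set0.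
  by have [G GP] := Omega_locally_small cla e20; exists G.
have /choice[s sP] : forall a, exists s : seq M, closure Omega a -> forall x,
    G a (set_val x) -> exists2 m, m \in s & mdist m (iota x) < e / 2.
  move=> a; have [cla|ncla] := pselect (closure Omega a); last by exists [::].
  by have [_ _ [s sP]] := GP a cla; exists s.
move: cO; rewrite compact_cover => /(_ X (closure Omega) G).
case=> [a /GP[]//|a cla|D DO OD].
  by exists a => //; have [] := GP a cla.
exists (flatten [seq s a | a <- finmap.enum_fset D]) => m _.
have [x xm] := iota_dense m e20.
have [a Da Gax] := OD _ (subset_closure (set_valX x)).
have cla : closure Omega a by apply/set_mem/DO.
have [m' m's m'x] := sP a cla x Gax.
exists m'.
  by apply/flattenP; exists (s a) => //; apply/mapP; exists a.
by have := metric_triangle m' (iota x) m; lra.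
Qed.

(** The points of [Omega] approaching [m] form a Cauchy filter in [X], because [iota] does not
    decrease distances; [a] is its limit. *)
Lemma projection_ex m :
  exists a : X, forall x, mdist (set_val x) a <= mdist (iota x) m.
Proof.
pose near_m (e : R) : set X := [set set_val x | x in [set x | mdist (iota x) m < e]].
pose F := filter_from [set e : R | 0 < e] near_m.
have FF : ProperFilter F.
  apply: filter_from_proper; last first.
    by move=> e /(iota_dense m)[x xm]; exists (set_val x), x.
  apply: filter_from_filter; first by exists 1 => /=.
  move=> e d /= e0 d0; exists (Num.min e d); first by rewrite /= lt_min e0.
  move=> a [x /= + xa]; rewrite lt_min -xa => /andP[xe xd].
  by split; exists x.
have /cauchy_cvg Fcvg : cauchy F.
  apply: cauchy_exP => e e0; have e20 : 0 < e / 2 by rewrite divr_gt0.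
  have [x xm] := iota_dense m e20; exists (set_val x), (e / 2) => //.
  move=> _ [y ym <-]; rewrite ballEmdist /=; apply: le_lt_trans (mdist_le_iota x y) _.
  have := metric_triangle (iota x) m (iota y); rewrite (metric_sym m).
  by move: ym => /=; lra.
exists (lim F) => x; apply/ler_addgt0Pr => e e0.
have e20 : 0 < e / 2 by rewrite divr_gt0.
have /Fcvg Fb := nbhsx_ballx (lim F) _ e20.
have Fm : F (near_m (e / 2)) by exists (e / 2).
have [b [+ [y /= ym yb]]] := filter_ex (filterI Fb Fm).
rewrite -yb ballEmdist /= => by_.
have := metric_triangle (set_val x) (set_val y) (lim F).
have := mdist_le_iota x y; have := metric_triangle (iota x) m (iota y).
by rewrite (metric_sym m) (metric_sym (set_val y)); lra.
Qed.

(** The continuous extension to [M] of the inclusion of [Omega] in [X]. *)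
Definition proj : M -> X := projT1 (choice projection_ex).

Lemma mdist_proj x m : mdist (set_val x) (proj m) <= mdist (iota x) m.
Proof. exact: (projT2 (choice projection_ex)). Qed.

(** If [proj m] were a point [x] of [Omega], points approaching [m] would approach [x] in [X], hence
    also [iota x] in [M] by continuity of [iota], and [m] would equal [iota x]. *)
Lemma proj_boundary m : ~ range iota m -> boundary Omega (proj m).
Proof.
move=> nm; split.
  apply/closure_mdist => e /(iota_dense m)[x xm]; exists (set_val x).
    exact: set_valX.
  by rewrite metric_sym; apply: le_lt_trans xm; exact: mdist_proj.
move=> /interior_subset/set_val_ex[x xm]; apply: nm; exists x => //.
apply: mdist_positivity; apply/eqP; rewrite eq_le mdist_ge0 andbT.
apply/ler_addgt0Pr => e e0; rewrite add0r.
have e20 : 0 < e / 2 by rewrite divr_gt0.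
have [d d0 dP] := iota_continuous x e20.
have [|y] := @iota_dense m (Num.min d (e / 2)); first by rewrite lt_min d0.
rewrite lt_min => /andP[yd ye].
have : mdist (iota x) (iota y) < e / 2.
  apply: dP; rewrite xm metric_sym; apply: le_lt_trans yd; exact: mdist_proj.
by have := metric_triangle (iota x) (iota y) m; lra.
Qed.

(** The other points of [M] project to the boundary of [Omega], away from [x]. This prevents ends
    from converging to points of [Omega]. *)
Lemma range_iota_open x : exists2 d : R, 0 < d &
  forall m, mdist (iota x) m < d -> range iota m.
Proof.
have [d d0 dO] := (open_mdist _).1 Omega_open _ (set_valX x).
exists d => // m xm; apply: contrapT => /proj_boundary/boundary_Omega; apply.
by apply: dO; apply: le_lt_trans xm; exact: mdist_proj.
Qed.

Lemma iota_inj : injective iota.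
Proof.
move=> x y xy; apply: val_inj; apply: mdist_positivity; apply/eqP.
by rewrite eq_le mdist_ge0 andbT; have := mdist_le_iota x y; rewrite xy mdistxx.
Qed.

(** * Necks *)

Let U m (r : R) : set X := Omega `&` ball (proj m) r.

Let U_ball m (r : R) a : U m r a -> mdist (proj m) a < r.
Proof. by move=> [_]; rewrite ballEmdist. Qed.

(* The union of the components of [Omega `&` ball (proj m) r] that come
   arbitrarily close to [m]; it is in fact a single component. *)
Definition neck m (r : R) : set X := \bigcup_(x in [set x | mdist (iota x) m < r])
  connected_component (Omega `&` ball (proj m) r) (set_val x).

Let near_U m r x : mdist (iota x) m < r -> U m r (set_val x).
Proof.
move=> xm; split; first exact: set_valX.
by rewrite ballEmdist /= metric_sym; apply: le_lt_trans xm; exact: mdist_proj.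
Qed.

(** The points [x] and [y] are joined by a connected set of diameter little more than [s]; as [y] is
    very close to [proj m] and [s < r], this set stays in the ball. *)
Let near_component m r x : mdist (iota x) m < r ->
  exists2 d : R, 0 < d & forall y, mdist (iota y) m < d ->
    connected_component (U m r) (set_val x) (set_val y).
Proof.
move=> xr; pose s := mdist (iota x) m; have sr : s < r by []; exists ((r - s) / 3).
  by rewrite divr_gt0// subr_gt0.
move=> y ym; have /mdist_iota_lt[C [cC CO Cx Cy] Cs] :
    mdist (iota x) (iota y) < s + (r - s) / 3.
  have := metric_triangle (iota x) m (iota y); rewrite (metric_sym m) -/s.
  by move: ym; lra.
exists C => //; split => // a Ca; split; first exact: CO.
rewrite ballEmdist /=; have := Cs _ _ Cy Ca; have := mdist_proj y m.
have := metric_triangle (proj m) (set_val y) a.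
by rewrite (metric_sym (proj m) (set_val y)); move: ym; lra.
Qed.

(** Each component of the union contains all points of [Omega] close enough to [m], so any two of
    them coincide. *)
Lemma neckE m r x : mdist (iota x) m < r ->
  neck m r = connected_component (Omega `&` ball (proj m) r) (set_val x).
Proof.
move=> xm; apply/seteqP; split=> [a [y /= ym ya]|a xa]; last by exists x.
have [d d0 dx] := near_component xm; have [d' d'0 d'y] := near_component ym.
have [|z] := @iota_dense m (Num.min d d'); first by rewrite lt_min d0.
rewrite lt_min => /andP[/dx xz /d'y yz].
apply: connected_component_trans ya; apply: connected_component_trans xz _.
exact: connected_component_sym.
Qed.

Lemma neck_near m r x : mdist (iota x) m < r -> neck m r (set_val x).
Proof. by move=> xm; exists x => //; exact/connected_component_refl/near_U. Qed.

Lemma neck_sub m r : neck m r `<=` Omega `&` ball (proj m) r.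
Proof. by move=> a [x _ /connected_component_sub]. Qed.

Lemma neck_connected m r : 0 < r -> connected (neck m r).
Proof.
by move=> /(iota_dense m)[x /neckE ->]; exact: component_connected.
Qed.

Lemma neck_max m r C : connected C -> C `<=` Omega `&` ball (proj m) r ->
  C `&` neck m r !=set0 -> C `<=` neck m r.
Proof.
move=> cC CU [a [Ca [x xm xa]]] b Cb; exists x => //.
by apply: connected_component_trans xa _; exists C.
Qed.

Lemma neck_mono m s r : s <= r -> neck m s `<=` neck m r.
Proof.
move=> sr a [x /= xs [C [Cx CU cC] Ca]]; exists x => /=.
  exact: lt_le_trans sr.
exists C => //; split => // b /CU[Ob sb]; split => //.
exact: le_ball sb.
Qed.

Lemma neck_diam m r a b : neck m r a -> neck m r b -> mdist a b <= 2 * r.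
Proof.
move=> /neck_sub/U_ball ma /neck_sub/U_ball mb.
by have := metric_triangle a (proj m) b; rewrite (metric_sym a (proj m)); lra.
Qed.

(** The neck is a connected set of diameter at most [2 * r] joining [x] to points arbitrarily close
    to [m]. *)
Lemma neck_mdist m r x : 0 < r -> neck m r (set_val x) ->
  mdist (iota x) m <= 2 * r.
Proof.
move=> r0 xm; apply/ler_addgt0Pr => e e0.
have [|y] := @iota_dense m (Num.min e r); first by rewrite lt_min e0.
rewrite lt_min => /andP[ye yr].
have : mdist (iota x) (iota y) <= 2 * r.
  apply: (mdist_iota_le (@neck_connected m _ r0)) => //.
  - by move=> a /neck_sub[].
  - exact: neck_near.
  - exact: neck_diam.
by have := metric_triangle (iota x) (iota y) m; lra.
Qed.

(** If [a] were inside the ball, small connected sets would join it to the neck and to all its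
    neighbours, making it an interior point of the neck. *)
Lemma neck_boundary m r a : Omega a -> boundary (neck m r) a ->
  mdist (proj m) a = r.
Proof.
move=> Oa [cla nia]; apply/eqP; rewrite eq_le; apply/andP; split.
  apply/ler_addgt0Pr => e /((closure_mdist _ _).1 cla)[b /neck_sub/U_ball mb ab].
  by have := metric_triangle (proj m) b a; rewrite (metric_sym b a); lra.
rewrite leNgt; apply/negP => mr; apply: nia.
have oU : open (U m r) by apply: openI; [exact: Omega_open|exact: mdist_ball_open].
have [|e e0 eU] := (open_mdist _).1 oU a.
  by split => //; rewrite ballEmdist.
have [d d0 dP] := lc_X a e0.
have [b nb /dP[C' [cC' C'e C'a C'b]]] := (closure_mdist _ _).1 cla d d0.
apply/nbhs_mdist; exists d => // c /dP[C [cC Ce Ca Cc]].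
have eU' : ball a e `<=` U m r by move=> z; rewrite ballEmdist; exact: eU.
have na : neck m r a.
  by apply: (neck_max cC') => //; [exact: subset_trans eU'|exists b].
by apply: (neck_max cC) => //; [exact: subset_trans eU'|exists a].
Qed.

(** * The chain of necks and the adherent points of chains *)

Lemma point_in_Omega : exists x : Omega, True.
Proof. by have [[a /set_val_ex[x _]] _ _ _] := Omega_domain; exists x. Qed.

(** The radius never exceeds the distance from [proj m] to a fixed point of [Omega]; the neck misses
    that point and is a proper subset, as acceptability requires. *)
Definition neck_radius m (k : nat) : R :=
  mdist (proj m) (set_val (projT1 (cid point_in_Omega))) / k.+1%:R.

Definition neck_chain m (k : nat) : set X := neck m (neck_radius m k).

Lemma neck_radius_gt0 m k : ~ range iota m -> 0 < neck_radius m k.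
Proof.
move=> nm; rewrite divr_gt0// mdist_gt0; apply/eqP => mx.
by apply: (boundary_Omega (proj_boundary nm)); rewrite mx; exact: set_valX.
Qed.

Lemma neck_radius_lt m k : ~ range iota m -> neck_radius m k.+1 < neck_radius m k.
Proof.
move=> nm; have /= := neck_radius_gt0 0 nm; rewrite /neck_radius divr1 => r0.
by rewrite ltr_pM2l// ltf_pV2 ?posrE// ltr_nat.
Qed.

Lemma neck_radius_small m (r : R) : 0 < r -> exists k, neck_radius m k < r.
Proof.
move=> r0; pose d := mdist (proj m) (set_val (projT1 (cid point_in_Omega))).
exists (Num.truncn (d / r)); rewrite /neck_radius -/d.
by rewrite ltr_pdivrMr// mulrC -ltr_pdivrMr// truncnS_gt.
Qed.

Lemma neck_chain_sub m (r : R) : 0 < r -> exists k, neck_chain m k `<=` neck m r.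
Proof.
by move=> /(neck_radius_small m)[k kr]; exists k; apply: neck_mono; exact: ltW.
Qed.

Lemma closure_neck_proj m r : 0 < r -> closure (neck m r) (proj m).
Proof.
move=> r0; apply/closure_mdist => e e0.
have [|x] := @iota_dense m (Num.min e r); first by rewrite lt_min e0.
rewrite lt_min => /andP[xe xr]; exists (set_val x); first exact: neck_near.
by rewrite metric_sym; apply: le_lt_trans xe; exact: mdist_proj.
Qed.

(** Inside [Omega] the boundaries of consecutive necks lie on spheres of different radii about
    [proj m], which gives the gap; the impression reduces to [proj m]. *)
Lemma neck_chainP m : ~ range iota m -> chain Omega (neck_chain m).
Proof.
move=> nm; have r0 k := neck_radius_gt0 k nm; split.
- move=> k; split.
  + split; first by move=> a /neck_sub[].
    set x := projT1 (cid point_in_Omega) => /(_ _ (set_valX x)).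
    move=> /neck_sub/U_ball; rewrite /neck_radius -/x.
    rewrite ltNge => /negP; apply; rewrite ler_pdivrMr//.
    by rewrite ler_peMr ?mdist_ge0// ler1n.
  + exact: neck_connected.
  + apply: (le_lt_trans (diam_le (@neck_diam m (neck_radius m k)))).
    exact: ltry.
  + exists (proj m); split; first exact: closure_neck_proj.
    exact: proj_boundary.
- by move=> k; apply: neck_mono; exact/ltW/neck_radius_lt.
- move=> k; apply: (@lt_le_trans _ _ (neck_radius m k - neck_radius m k.+1)%:E).
    by rewrite lte_fin subr_gt0 neck_radius_lt.
  apply: le_ereal_inf_tmp => _ [a [Oa ba] [b [Ob bb] <-]]; rewrite lee_fin.
  have := neck_boundary Oa ba; have := neck_boundary Ob bb.
  by have := metric_triangle (proj m) a b; lra.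
- move=> a ca; suff -> : a = proj m by exact: proj_boundary.
  apply/esym/mdist_positivity/eqP; rewrite eq_le mdist_ge0 andbT.
  apply/ler_addgt0Pr => e e0; rewrite add0r.
  have e20 : 0 < e / 2 by rewrite divr_gt0.
  have [k ke] := neck_radius_small m e20.
  have [b /neck_sub/U_ball mb ab] := (closure_mdist _ _).1 (ca k I) _ e20.
  by have := metric_triangle (proj m) b a; rewrite (metric_sym b a); lra.
Qed.

(** The analogue in [M] of belonging to the impression. *)
Definition adherent (F : nat -> set X) m := forall k (e : R), 0 < e ->
  exists2 x, F k (set_val x) & mdist m (iota x) < e.

Lemma adherent_divides (E F : nat -> set X) m :
  chain_divides E F -> adherent E m -> adherent F m.
Proof.
by move=> EF Em k e e0; have [l lk] := EF k; have [x /lk Fx xm] := Em l e e0; exists x.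
Qed.

Lemma adherent_neck_chain m m' : ~ range iota m ->
  adherent (neck_chain m) m' <-> m' = m.
Proof.
move=> nm; split=> [am|->]; last first.
  move=> k e e0.
  have [|x] := @iota_dense m (Num.min e (neck_radius m k)).
    by rewrite lt_min e0 neck_radius_gt0.
  rewrite lt_min => /andP[xe xk]; exists x; last by rewrite metric_sym.
  exact: neck_near.
apply: mdist_positivity; apply/eqP; rewrite eq_le mdist_ge0 andbT.
apply/ler_addgt0Pr => e e0; rewrite add0r.
have e40 : 0 < e / 4 by rewrite divr_gt0.
have [k ke] := neck_radius_small m e40.
have [x /(neck_mdist (neck_radius_gt0 k nm)) xm m'x] := am k _ e40.
by have := metric_triangle m' (iota x) m; lra.
Qed.

Lemma adherent_boundary F m : chain Omega F -> adherent F m -> ~ range iota m.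
Proof.
move=> [_ _ _ Fb] Fm [x _ xm]; have /boundary_Omega : boundary Omega (set_val x).
  apply: Fb => k _; apply/closure_mdist => e /(Fm k)[y Fy my].
  by exists (set_val y) => //; apply: le_lt_trans my; rewrite -xm; exact: mdist_le_iota.
by apply; exact: set_valX.
Qed.

(* Near [m] every point of the chain [F] can be joined inside a small set that
   cannot cross the gap between two consecutive boundaries of [F]. *)
Lemma neck_sub_chain F m k : chain Omega F -> adherent F m ->
  exists2 r : R, 0 < r & neck m r `<=` F k.
Proof.
move=> [accF decF gapF _] Fm.
have [d d0 gap] : exists2 d : R, 0 < d & forall a b, Omega a -> Omega b ->
    boundary (F k.+1) a -> boundary (F k) b -> d <= mdist a b.
  have [d /andP[d0 dg]] : exists d : R, (0 < d%:E <= set_dist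
      (Omega `&` boundary (F k.+1)) (Omega `&` boundary (F k)))%E.
    move: (gapF k); case: (set_dist _ _) => [d|_|//].
      by move=> d0; exists d; rewrite d0 lexx.
    (* The distance is [+oo] when one of the sets is empty; any positive number then serves. *)
    by exists 1; rewrite leey andbT lte_fin.
  exists d => // a b Oa Ob ba bb; rewrite -lee_fin; apply: (le_trans dg).
  by apply: ereal_inf_lbound; exists a => //; exists b.
(* The neck of radius [d / 3] has diameter at most [2 * d / 3], less than the gap. *)
have r0 : 0 < d / 3 by rewrite divr_gt0.
exists (d / 3) => // z nz; apply: contrapT => Fz.
have [x Fx mx] := Fm k.+1 _ r0.
have nx : neck m (d / 3) (set_val x) by apply: neck_near; rewrite metric_sym.
have cn := @neck_connected m _ r0.
have [a [na ba]] : neck m (d / 3) `&` boundary (F k.+1) !=set0.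
  by apply: connected_boundary => //; [exists (set_val x)|exists z; split => // /decF].
have [b [nb bb]] : neck m (d / 3) `&` boundary (F k) !=set0.
  apply: connected_boundary => //; last by exists z.
  by exists (set_val x); split => //; exact: decF.
have := gap _ _ (neck_sub na).1 (neck_sub nb).1 ba bb.
by have := neck_diam na nb; lra.
Qed.

Lemma neck_chain_divides F m : chain Omega F -> adherent F m ->
  chain_divides (neck_chain m) F.
Proof.
move=> cF Fm k; have [r r0 rF] := neck_sub_chain k cF Fm.
by have [l lr] := neck_chain_sub m r0; exists l; exact: subset_trans rF.
Qed.

(** By compactness [m_] has a cluster point in [K]; each [F k] has points arbitrarily close to
    [m_ n] for large [n], hence also to the cluster point. *)
Lemma cluster_tail_points (F : nat -> set X) (m_ : nat -> M) (K : set M) :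
  closed K -> (forall n, K (m_ n)) ->
  (forall k, exists N, forall n, (N <= n)%N -> forall e : R, 0 < e ->
    exists2 x, F k (set_val x) & mdist (m_ n) (iota x) < e) ->
  exists2 m, K m & adherent F m.
Proof.
move=> clK Km mF; have cK := subclosed_compact clK completion_compact (@subsetT _ K).
have [|m [Km' clm]] := cK (m_ @ \oo).
  by exists 0%N => // n _; exact: Km.
exists m => // k e e0; have e20 : 0 < e / 2 by rewrite divr_gt0.
have [N FN] := mF k.
have [_ [[n Nn <-]]] := clm (m_ @` [set n | (N <= n)%N]) (ball m (e / 2))
  (ex_intro2 _ _ N I (fun n Nn => ex_intro2 _ _ n Nn erefl))
  (nbhsx_ballx m _ e20).
rewrite ballEmdist /= => mn; have [x Fx nx] := FN n Nn _ e20; exists x => //.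
by have := metric_triangle m (m_ n) (iota x); lra.
Qed.

Lemma chain_nonincreasing (F : nat -> set X) k n :
  (forall i, F i.+1 `<=` F i) -> (k <= n)%N -> F n `<=` F k.
Proof.
move=> decF; elim: n => [|n IHn]; first by rewrite leqn0 => /eqP ->.
by rewrite leq_eqVlt => /predU1P[->//|/IHn]; exact: subset_trans.
Qed.

Lemma chain_adherent_ex F : chain Omega F -> exists m, adherent F m.
Proof.
move=> [accF decF _ _].
have /choice[x xF] : forall k, exists x : Omega, F k (set_val x).
  (* Acceptable sets are nonempty because their closure meets the boundary of [Omega]. *)
  move=> k; have [[FO _] _ _ [a [clF _]]] := accF k.
  have [b Fb _] := (closure_mdist _ _).1 clF 1 ltr01.
  by have [x xb] := set_val_ex (FO b Fb); exists x; rewrite xb.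
have [||k|m _ Fm] := @cluster_tail_points F (iota \o x) setT; last by exists m.
- exact: closedT.
- by [].
exists k => n kn e e0; exists (x n); last by rewrite mdistxx.
by apply: (chain_nonincreasing decF kn); exact: xF.
Qed.

Lemma chain_divides_trans (E F G : nat -> set X) :
  chain_divides E F -> chain_divides F G -> chain_divides E G.
Proof.
move=> EF FG k; have [l lk] := FG k; have [j jl] := EF l.
by exists j; exact: subset_trans lk.
Qed.

Lemma chain_equiv_refl (E : nat -> set X) : chain_equiv E E.
Proof. by split=> k; exists k. Qed.

Lemma chain_equiv_sym (E F : nat -> set X) : chain_equiv E F -> chain_equiv F E.
Proof. by case. Qed.

Lemma chain_equiv_trans (E F G : nat -> set X) :
  chain_equiv E F -> chain_equiv F G -> chain_equiv E G.
Proof.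
by move=> [EF FE] [FG GF]; split; [exact: chain_divides_trans FG|
  exact: chain_divides_trans FE].
Qed.

(** * Prime ends are the ends of the necks *)

Implicit Types (f g : end_ Omega).

Lemma end_classE f F : end_class f F ->
  end_class f = [set G | chain Omega G /\ chain_equiv F G].
Proof.
case: f => C /= /[dup] [[E cE CE]] _; rewrite CE => -[cF EF].
apply/seteqP; split=> G [cG h]; split => //.
  exact: chain_equiv_trans (chain_equiv_sym EF) h.
exact: chain_equiv_trans EF h.
Qed.

Lemma end_class_chain f F : end_class f F -> chain Omega F.
Proof. by case: f => C /= [E cE ->] []. Qed.

Lemma end_class_ex f : exists F, end_class f F.
Proof.
case: f => C /= [E cE ->]; exists E; split => //; exact: chain_equiv_refl.
Qed.

Lemma end_class_equiv f F G : end_class f F -> end_class f G -> chain_equiv F G.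
Proof. by move=> /end_classE -> []. Qed.

Lemma end_ext f g F : end_class f F -> end_class g F -> f = g.
Proof.
move=> /end_classE fE /end_classE gE; have : end_class f = end_class g.
  by rewrite fE gE.
case: f g {fE gE} => C CP [D DP] /= CD.
by move: CP; rewrite CD => CP; congr End; exact: Prop_irrelevance.
Qed.

Lemma end_of_chain F : chain Omega F -> exists f, end_class f F.
Proof.
move=> cF; exists (@End _ _ _ _ (ex_intro2 _ _ F cF erefl)).
by split => //; exact: chain_equiv_refl.
Qed.

(** A chain that divides the necks has adherent points, all of them adherent to the necks and so
    equal to [m]; the necks then divide it in turn. *)
Lemma neck_end_prime f m : end_class f (neck_chain m) -> ~ range iota m ->
  prime_end f.
Proof.
move=> fm nm g [G [F [gG fF GF]]]; have cG := end_class_chain gG.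
have Gm : chain_divides G (neck_chain m).
  by apply: chain_divides_trans GF _; have [] := end_class_equiv fF fm.
have [m' Gm'] := chain_adherent_ex cG.
have m'm : m' = m.
  by apply/(adherent_neck_chain _ nm); exact: adherent_divides Gm'.
have mG : chain_divides (neck_chain m) G.
  by apply: neck_chain_divides => //; rewrite -m'm.
apply: (@end_ext _ _ (neck_chain m)) => //.
by rewrite (end_classE gG); split => //; exact: end_class_chain fm.
Qed.

(** The end of the necks divides [f], and primality turns this into equality. *)
Lemma prime_end_neck f F m : prime_end f -> end_class f F -> adherent F m ->
  end_class f (neck_chain m).
Proof.
move=> pf fF Fm; have cF := end_class_chain fF.
have [g gm] := end_of_chain (neck_chainP (adherent_boundary cF Fm)).
suff <- : g = f by [].
apply: pf; exists (neck_chain m), F; split => //.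
exact: neck_chain_divides.
Qed.

(** The graph of [Phi]; an end that is not prime is related to no point of [M]. *)
Definition represents (y : ends_closure Omega) m : Prop := match y with
  | ptE x => iota x = m
  | endE f => end_class f (neck_chain m) /\ ~ range iota m
  end.

Lemma represents_ex (y : ends_closure Omega) :
  prime_end_closure Omega y -> exists m, represents y m.
Proof.
case: y => [x _|f pf]; first by exists (iota x).
have [F fF] := end_class_ex f; have cF := end_class_chain fF.
have [m Fm] := chain_adherent_ex cF; exists m; split.
  exact: prime_end_neck Fm.
exact: adherent_boundary Fm.
Qed.

Lemma represents_surj m :
  exists2 y : ends_closure Omega, prime_end_closure Omega y & represents y m.
Proof.
have [[x _ xm]|nm] := pselect (range iota m); first by exists (ptE x).
have [f fm] := end_of_chain (neck_chainP nm); exists (endE f) => //.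
exact: neck_end_prime fm nm.
Qed.

Lemma represents_inj (y z : ends_closure Omega) m :
  represents y m -> represents z m -> y = z.
Proof.
case: y z => [x|f] [x'|g] /=.
- by move=> <- /iota_inj ->.
- by move=> <- [_]; case; exists x.
- by move=> [_ nm] xm; case: nm; exists x'.
- by move=> [fm nm] [gm _]; congr endE; exact: end_ext fm gm.
Qed.

Lemma represents_fun (y : ends_closure Omega) m m' :
  represents y m -> represents y m' -> m = m'.
Proof.
case: y => [x|f] /=; first by move=> <- <-.
move=> [fm nm] [fm' nm']; apply/(adherent_neck_chain _ nm').
have [mm' _] := end_class_equiv fm fm'.
by apply: (adherent_divides mm'); exact/adherent_neck_chain.
Qed.

(** * Sequential convergence compared with convergence in [M] *)

Lemma represents_cvg (z : nat -> ends_closure Omega) (y : ends_closure Omega)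
    (m_ : nat -> M) m :
  seq_cvg z y -> (forall n, represents (z n) (m_ n)) -> represents y m ->
  forall e : R, 0 < e -> exists N, forall n, (N <= n)%N -> mdist (m_ n) m < e.
Proof.
have tail (F : nat -> set X) f : end_class f F -> end_class f (neck_chain m) ->
    forall e : R, 0 < e -> exists r k, [/\ 0 < r, 2 * r < e & F k `<=` neck m r].
  move=> fF fm e e0; have r0 : 0 < e / 4 by rewrite divr_gt0.
  have [i ir] := neck_chain_sub m r0.
  have [/(_ i)[k ki] _] := end_class_equiv fF fm.
  by exists (e / 4), k; split; [by []|lra|exact: subset_trans ir].
case=> [x a xa|x f [F fF xF]|g f [E [F [gE fF EF]]]] /= zm.
- move=> <- e e0; have [d d0 dP] := iota_continuous a e0.
  have /metricType_numDomainType.cvgrPdist_lt/(_ d d0)[N _ NP] := xa.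
  exists N => n /NP /= /dP; rewrite -zm metric_sym; exact.
- move=> [fm nm] e e0; have [r [k [r0 re kr]]] := tail F f fF fm e e0.
  have [N NP] := xF k; exists N => n /NP/kr nx; rewrite -zm.
  by apply: le_lt_trans re; exact: neck_mdist.
- move=> [fm nm] e e0; have [r [k [r0 re kr]]] := tail F f fF fm e e0.
  have [N NP] := EF k; exists N => n /NP[l lk]; have [gm gnm] := zm n.
  have [/(_ l)[j jl] _] := end_class_equiv gm (gE n).
  apply: le_lt_trans re; apply/ler_addgt0Pr => d d0.
  (* Points arbitrarily close to [m_ n] lie in [neck m r], so [m_ n] itself is within [2 * r] of
     [m]. *)
  have /(_ j d d0)[x nx mx] := (adherent_neck_chain (m_ n) gnm).2 erefl.
  have := neck_mdist r0 (kr _ (lk _ (jl _ nx))).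
  by have := metric_triangle (m_ n) (iota x) m; lra.
Qed.

Lemma cvg_points (x : nat -> Omega) (y : ends_closure Omega) m : represents y m ->
  (forall e : R, 0 < e -> exists N, forall n, (N <= n)%N ->
    mdist m (iota (x n)) < e) ->
  seq_cvg (fun n => ptE (x n)) y.
Proof.
case: y => [a am|f [fm nm]] xm.
  apply: cvg_points_point; apply/metricType_numDomainType.cvgrPdist_lt => e e0.
  have [N NP] := xm e e0; exists N => // n /= Nn.
  by apply: le_lt_trans (mdist_le_iota _ _) _; rewrite am; exact: NP.
apply: cvg_points_end; exists (neck_chain m) => // k.
have [N NP] := xm _ (neck_radius_gt0 k nm); exists N => n Nn.
by apply: neck_near; rewrite metric_sym; exact: NP.
Qed.

Lemma cvg_ends (g : nat -> end_ Omega) (m_ : nat -> M) f m :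
  represents (endE f) m -> (forall n, represents (endE (g n)) (m_ n)) ->
  (forall e : R, 0 < e -> exists N, forall n, (N <= n)%N -> mdist m (m_ n) < e) ->
  seq_cvg (fun n => endE (g n)) (endE f).
Proof.
move=> [fm nm] gm mm; apply: cvg_ends_end.
exists (fun n => neck_chain (m_ n)), (neck_chain m); split => // [n|k].
  by have [] := gm n.
pose r := neck_radius m k; have r0 : 0 < r := neck_radius_gt0 k nm.
have r40 : 0 < r / 4 by rewrite divr_gt0.
have [N NP] := mm _ r40; exists N => n /NP mn.
(* The points of this neck are within [r / 2] of [m_ n], itself within [r / 4] of [m], hence less
   than [r] from [m]. *)
have [l lr] := neck_chain_sub (m_ n) r40; exists l => a /[dup] la /lr na.
have [x xa] := set_val_ex (neck_sub na).1; rewrite -xa; apply: neck_near.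
have nx : neck (m_ n) (r / 4) (set_val x) by rewrite xa.
have := neck_mdist r40 nx; have := metric_triangle (iota x) (m_ n) m.
by rewrite (metric_sym (m_ n)) -/r; lra.
Qed.

(** * The homeomorphism and the two topologies *)

Section homeomorphism_onto_completion.

Local Notation T := (prime_end_closure Omega).

Lemma Phi_ex : exists Phi : T -> M, forall y : T, represents (set_val y) (Phi y).
Proof.
have /choice[Phi PhiP] : forall y : T, exists m, represents (set_val y) m.
  by move=> y; apply: represents_ex; exact: set_valP.
by exists Phi.
Qed.

Variable Phi : T -> M.
Hypothesis PhiP : forall y : T, represents (set_val y) (Phi y).

Let m_P (y z : T) := mdist (Phi y) (Phi z).

Lemma Phi_represents (y : T) m : represents (set_val y) m -> Phi y = m.
Proof. exact: represents_fun. Qed.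

Lemma Phi_inj : injective Phi.
Proof.
move=> y z yz; apply: val_inj; apply: (@represents_inj _ _ (Phi y)).
  exact: PhiP.
by rewrite yz; exact: PhiP.
Qed.

Lemma Phi_surj m : exists y : T, Phi y = m.
Proof.
have [y py ym] := represents_surj m.
by exists (exist _ y (mem_set py)); exact: Phi_represents.
Qed.

Lemma Phi_pt x : Phi (ptP x) = iota x.
Proof. exact: Phi_represents. Qed.

Lemma m_P_metric : is_metric m_P.
Proof.
split=> [y z|y z|y z|y z w]; rewrite /m_P.
- exact: mdist_ge0.
- by split=> [/mdist_positivity/Phi_inj//|->]; exact: mdistxx.
- exact: metric_sym.
- exact: metric_triangle.
Qed.

Lemma metric_open_closed (A : set T) : metric_open m_P A -> prime_seq_closed (~` A).
Proof.
move=> oA z y zA zy Ay; have [r r0 rA] := oA y Ay.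
have [N NP] := represents_cvg zy (fun n => PhiP (z n)) (PhiP y) r0.
by apply: (zA N); apply: rA; rewrite /= /m_P metric_sym; exact: NP.
Qed.

(** If [A] is not a neighbourhood of [y], points outside [A] converge to [y]. As [seq_cvg] does not
    mix points and ends, either points of [Omega] outside [A] come arbitrarily close to [y], or
    below some scale [e0] only ends do. *)
Lemma closed_metric_open (A : set T) : prime_seq_closed (~` A) -> metric_open m_P A.
Proof.
move=> cA y Ay; apply: contrapT => /forall2NP nA.
have near_y (e : R) : 0 < e -> exists2 z : T, ~ A z & m_P y z < e.
  move=> e0; have [//|/existsNP[z /not_implyP[zy nAz]]] := nA e.
  by exists z.
have inv0 (e : R) : 0 < e -> exists N, forall n, (N <= n)%N -> n.+1%:R^-1 < e.
  move=> e0; exists (Num.truncn e^-1) => n Nn.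
  rewrite invf_plt ?posrE//; apply: lt_le_trans (truncnS_gt _) _.
  by rewrite ler_nat.
have n0 n : 0 < n.+1%:R^-1 :> R by rewrite invr_gt0.
have [pts|/existsNP[e0 /not_implyP[e00 nopts]]] := pselect (forall e : R, 0 < e ->
    exists2 x : Omega, ~ A (ptP x) & m_P y (ptP x) < e).
  have /choice[x xP] : forall n, exists x : Omega,
      ~ A (ptP x) /\ m_P y (ptP x) < n.+1%:R^-1.
    by move=> n; have [x nAx yx] := pts _ (n0 n); exists x.
  apply: (cA (fun n => ptP (x n)) y) => // [n|]; first by have [] := xP n.
  apply: (cvg_points (PhiP y)) => e /inv0[N NP]; exists N => n /NP ne.
  by rewrite -Phi_pt; apply: lt_trans ne; have [] := xP n.
have /choice[g gP] : forall n, exists g : end_ Omega, exists z : T,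
    [/\ set_val z = endE g, ~ A z & m_P y z < n.+1%:R^-1].
  move=> n; have [|z nAz] := near_y (Num.min e0 n.+1%:R^-1).
    by rewrite lt_min e00 n0.
  rewrite lt_min => /andP[ze zn]; case zE : (set_val z) => [x|g]; last by exists g, z.
  exfalso; apply: nopts; exists x; first by rewrite (_ : ptP x = z)//; exact: val_inj.
  by rewrite (_ : ptP x = z)//; exact: val_inj.
have [z zP] := choice gP.
apply: (cA z y) => // [n|]; first by have [] := zP n.
have -> : (fun n => set_val (z n)) = (fun n => endE (g n)).
  by apply/funext => n; have [] := zP n.
have small (e : R) : 0 < e ->
    exists N, forall n, (N <= n)%N -> mdist (Phi y) (Phi (z n)) < e.
  by move=> /inv0[N NP]; exists N => n /NP; apply: lt_trans; have [] := zP n.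
have gm n : represents (endE (g n)) (Phi (z n)).
  by have [<- _ _] := zP n; exact: PhiP.
have := PhiP y; case yE : (set_val y) => [a|f].
  (* A point of [Omega] cannot be the limit of ends, since the image of [Omega] is open in [M]. *)
  move=> /= ya; have [d d0 dr] := range_iota_open a.
  have [N NP] := small d d0; have [_ []] := gm N; apply: dr.
  by rewrite ya; exact: NP.
by move=> yf; apply: (cvg_ends yf gm).
Qed.

Lemma ends_openE (A : set (ends_closure Omega)) : open A <-> seq_closed (~` A).
Proof. by []. Qed.

Lemma open_metric_open (A : set T) : open A -> metric_open m_P A.
Proof.
move=> [B oB BA]; apply: closed_metric_open => z y zA zy Ay.
have /ends_openE cB := oB.
have nBz n : ~ B (set_val (z n)) by move=> Bz; apply: (zA n); rewrite -BA.
have /(_ zy) := cB (fun n => set_val (z n)) (set_val y) nBz.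
by apply; move: Ay; rewrite -BA.
Qed.

(* The complement of [A] is cut out of the closed set of the points and
   (possibly non-prime) ends that have a limit point outside [Phi @` A]. *)
Lemma metric_open_open (A : set T) : metric_open m_P A -> open A.
Proof.
move=> oA; pose K := Phi @` (~` A).
have clK : closed K.
  move=> m /closure_mdist clm; have [y ym] := Phi_surj m.
  exists y => // Ay; have [r r0 rA] := oA y Ay.
  have [_ [z nAz <-] mz] := clm r r0.
  by apply: nAz; apply: rA; rewrite /= /m_P ym.
pose C : set (ends_closure Omega) := [set y | match y with
  | ptE x => K (iota x)
  | endE f => exists2 m, K m & exists2 F, end_class f F & adherent F m end].
have cC : seq_closed C.
  (* When the limit is an end, compactness of [M] gives it an adherent point in [K]: a cluster point
     of the points, or of adherent points chosen for the ends. *)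
  move=> z y + zy; case: zy => [x a xa|x f [F fF xF]|g f [E [F [gE fF EF]]]] /= zC.
  - apply: clK; apply/closure_mdist => e e0.
    have [d d0 dP] := iota_continuous a e0.
    have /metricType_numDomainType.cvgrPdist_lt/(_ d d0)[N _ NP] := xa.
    by exists (iota (x N)); [exact: zC|apply: dP; exact: NP (leqnn N)].
  - have [|m Km Fm] := @cluster_tail_points F (iota \o x) K clK zC.
      move=> k; have [N NP] := xF k; exists N => n /NP Fx e e0.
      by exists (x n) => //; rewrite mdistxx.
    by exists m => //; exists F.
  - have /choice[m_ mP] : forall n, exists m, K m /\ adherent (E n) m.
      move=> n; have [m Km [G gG Gm]] := zC n; exists m; split => //.
      by apply: adherent_divides Gm; have [] := end_class_equiv gG (gE n).
    have [||m Km Fm] := @cluster_tail_points F m_ K clK.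
    + by move=> n; have [] := mP n.
    + move=> k; have [N NP] := EF k; exists N => n /NP[l lk] e e0.
      by have [_ /(_ l e e0)[x /lk Fx mx]] := mP n; exists x.
    + by exists m => //; exists F.
exists (~` C); first by apply/ends_openE; rewrite setCK.
(* The only adherent point of a prime end [y] is [Phi y], so on the prime end closure [C] is the
   complement of [A]. *)
apply/seteqP; split=> y /=.
  move=> nC; apply: contrapT => nAy; apply: nC.
  have Ky : K (Phi y) by exists y.
  have := PhiP y; rewrite /C /=; case: (set_val y) => [x /= ->//|f [fm nm]].
  by exists (Phi y) => //; exists (neck_chain (Phi y)) => //; exact/adherent_neck_chain.
move=> Ay Cy; have : K (Phi y).
  have := PhiP y; move: Cy; rewrite /C /=; case: (set_val y) => [x Kx <-//|f].
  move=> [m Km [F fF Fm]] [fm nm]; suff <- : m = Phi y by [].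
  apply/(adherent_neck_chain _ nm); apply: adherent_divides Fm.
  by have [] := end_class_equiv fF fm.
by move=> [y' nAy' /Phi_inj yy']; apply: nAy'; rewrite yy'.
Qed.

Lemma Phi_homeomorphism : homeomorphism Phi.
Proof.
split.
  apply/continuousP => A oA; apply: metric_open_open => y /= Ay.
  have [r r0 rA] := (open_mdist _).1 oA _ Ay.
  by exists r => // z; exact: rA.
have [Psi PsiK] := choice Phi_surj.
exists Psi; first by split=> // y; apply: Phi_inj; rewrite PsiK.
apply/continuousP => A /open_metric_open oA; apply/open_mdist => m /= Am.
have [r r0 rA] := oA _ Am; exists r => // m' mm'; apply: rA.
by rewrite /= /m_P !PsiK.
Qed.

End homeomorphism_onto_completion.
(** The measure enters only through the compactness of closed balls and local connectedness, assumed
    in this section. *)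
Theorem prime_end_closure_completion :
  exists Phi : prime_end_closure Omega -> M,
    let m_P := fun x y : prime_end_closure Omega => mdist (Phi x) (Phi y) in
    [/\ homeomorphism Phi,
        forall x : Omega, Phi (ptP x) = iota x,
        is_metric m_P,
        forall A : set (prime_end_closure Omega), open A <-> metric_open m_P A &
        forall A : set (prime_end_closure Omega),
          prime_seq_closed A <-> metric_open m_P (~` A)].
Proof.
have [Phi PhiP] := Phi_ex; exists Phi => m_P; split.
- exact: Phi_homeomorphism PhiP.
- exact: Phi_pt PhiP.
- exact: m_P_metric PhiP.
- by move=> A; split; [exact: (open_metric_open PhiP)|exact: (metric_open_open PhiP)].
- move=> A; split=> [cA|/(metric_open_closed PhiP)]; last by rewrite setCK.
  by apply: (closed_metric_open PhiP); rewrite setCK.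
Qed.

End mazurkiewicz_completion_theory.

Theorem corollary10p9 (R : realType) (X : completeMetricType R)
    (mu : {measure set (borel X) -> \bar R}) (p : R) (Omega : set X)
    (M : completeMetricType R) (iota : Omega -> M) :
  (exists x y : X, x <> y) ->
  1 <= p ->
  finite_positive_on_balls mu ->
  doubling mu ->
  poincare mu p ->
  bounded_domain Omega ->
  Omega `<` setT ->
  finitely_connected_at_boundary Omega ->
  mazurkiewicz_completion iota ->
  exists Phi : prime_end_closure Omega -> M,
    let m_P := fun x y : prime_end_closure Omega => mdist (Phi x) (Phi y) in
    [/\ homeomorphism Phi,
        forall x : Omega, Phi (ptP x) = iota x,
        is_metric m_P,
        forall A : set (prime_end_closure Omega), open A <-> metric_open m_P A &
        forall A : set (prime_end_closure Omega),
          prime_seq_closed A <-> metric_open m_P (~` A)].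
Proof.
move=> _ p1 mu_ball mu_doubling mu_poincare dO _ fcO iotaP.
apply: prime_end_closure_completion => //.
- by move=> x r; exact: (doubling_compact mu_ball mu_doubling).
- exact: (poincare_locally_connected p1 mu_ball mu_doubling mu_poincare).
Qed.
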